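(* Let $D\subset\mathbb{R}^2$ be a bounded simply connected domain with $C^1$ boundary, let $\gamma_0,\gamma_1>0$ be constants, $k=\gamma_1/\gamma_0$, and let $N_1,N_2$ be positive integers, $n_p=2N_1$, $n_q=2N_2$. Assume that there is a constant $\kappa<1$ such that $|x-y|<\kappa$ for all $x,y\in\partial D$ (which holds in particular if the perimeter of $D$ is smaller than $2\kappa$). Let $\mathcal{P}\in\mathbb{R}^{n_p\times n_p}$, $\mathcal{Q}\in\mathbb{R}^{n_q\times n_q}$ and $\mathcal{N}\in\mathbb{R}^{n_p\times n_q}$ be the matrices $$\mathcal{P}_{i,j}=\int_{\partial D^2}\frac{\partial P_i}{\partial\tau}(y)\frac{\partial P_j}{\partial\tau}(x)\,\Gamma(x-y)\,d\sigma(x)d\sigma(y),\qquad \mathcal{Q}_{i,j}=\int_{\partial D^2}Q_j(x)\,Q_i(y)\,\Gamma(x-y)\,d\sigma(x)d\sigma(y),$$ $$\mathcal{N}_{i,j}=\int_{\partial D^2}Q_j(y)\,P_i(x)\,\frac{\partial\Gamma(x-y)}{\partial\nu_x}\,d\sigma(x)d\sigma(y).$$ Then $\mathcal{P}$ and $\mathcal{Q}$ are symmetric negative definite, and the matrix $$\mathcal{M}=\begin{pmatrix}(k+1)\mathcal{P} & 2k\,\mathcal{N}\\ -2\,\mathcal{N}^T & (k+1)\mathcal{Q}\end{pmatrix}$$ has positive determinant. Consequently the linear system $\mathcal{M}X=\mathcal{B}$ is well-posed (uniquely solvable for every right-hand side $\mathcal{B}$).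
   Context: Let $a_n(x)=\Re((x_1+ix_2)^n)$ and $b_n(x)=\Im((x_1+ix_2)^n)$ for $n\ge1$. For $1\le i\le n_p$, $P_i=a_{(i+1)/2}$ if $i$ is odd and $P_i=b_{i/2}$ if $i$ is even. For $1\le i\le n_q$, $Q_i=\nabla a_{(i+1)/2}\cdot\nu$ if $i$ is odd and $Q_i=\nabla b_{i/2}\cdot\nu$ if $i$ is even, as functions on $\partial D$. Here $\partial D^2=\partial D\times\partial D$, $\sigma$ is arclength measure on $\partial D$, $\nu$ is the unit normal pointing outside $D$, $\partial/\partial\tau$ is the tangential (arclength) derivative along $\partial D$ for a fixed orientation, $\Gamma(x)=\frac{1}{2\pi}\ln|x|$, and $\frac{\partial\Gamma(x-y)}{\partial\nu_x}=\nu(x)\cdot\nabla_x\Gamma(x-y)$, with the corresponding integral on $\partial D$ understood as a principal-value boundary integral operator. The origin is taken to be the center of mass of $D$. *)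

(* Defs.v *)
From HB Require Import structures.
From mathcomp Require Import all_boot all_order all_algebra.
From mathcomp Require Import all_classical all_reals all_analysis.
From mathcomp Require Import complex.

Set Implicit Arguments.
Unset Strict Implicit.
Unset Printing Implicit Defensive.

Import Order.TTheory GRing.Theory Num.Theory.
Import numFieldNormedType.Exports.

Local Open Scope classical_set_scope.
Local Open Scope ring_scope.

Definition dot {R : realType} (u v : R * R) : R := u.1 * v.1 + u.2 * v.2.

(* The library norm of R * R is the sup norm; it induces the same topology and
   bounded sets, but |x| in the statement is the Euclidean norm. *)
Definition enorm {R : realType} (u : R * R) : R := Num.sqrt (dot u u).

Definition grad {R : realType} (f : R * R -> R) (x : R * R) : R * R :=
  ('D_(1, 0) f x, 'D_(0, 1) f x).

Definition plane_measure {R : realType} :=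
  ((@lebesgue_measure R) \x (@lebesgue_measure R))%E.

Definition frontier {R : realType} (D : set (R * R)) : set (R * R) :=
  closure D `\` interior D.

Definition domain {R : realType} (D : set (R * R)) : Prop :=
  [/\ D !=set0, open D & connected D].

Definition simply_connected {R : realType} (D : set (R * R)) : Prop :=
  connected D /\
  forall c : R -> R * R,
    {within `[0, 1], continuous c} -> c @` `[0, 1] `<=` D -> c 0 = c 1 ->
    exists H : R * R -> R * R,
      [/\ {within `[0, 1] `*` `[0, 1], continuous H},
          H @` (`[0, 1] `*` `[0, 1]) `<=` D,
          forall t : R, t \in `[0, 1] -> H (0, t) = c t /\ H (1, t) = c 0 &
          forall u : R, u \in `[0, 1] -> H (u, 0) = c 0 /\ H (u, 1) = c 0].

Definition C1 {R : realType} {V : normedModType R} (f : R -> V) : Prop :=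
  (forall t, derivable f t 1) /\ continuous (derive1 f).

(* Near each boundary point D is the strict epigraph of a C^1 function, in the
   orthonormal frame (e rotated by -pi/2, e). *)
Definition C1_boundary {R : realType} (D : set (R * R)) : Prop :=
  forall x0, frontier D x0 ->
    exists (r : R) (e : R * R) (phi : R -> R),
      [/\ 0 < r, enorm e = 1, C1 phi &
          forall x, enorm (x - x0) < r ->
            (D x <-> phi (dot x (e.2, - e.1)) < dot x e)].

Definition center_of_mass {R : realType} (D : set (R * R)) : R * R :=
  ((\int[plane_measure]_(x in D) x.1) / fine (plane_measure D),
   (\int[plane_measure]_(x in D) x.2) / fine (plane_measure D)).

(* gamma runs once around the boundary of D at unit speed, with period equal to
   the perimeter L.  The choice of gamma is the choice of an orientation (and
   of a base point); arclength measure is the image of ds on [0, L[. *)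
Definition arclength_param {R : realType} (D : set (R * R))
    (L : R) (gamma : R -> R * R) : Prop :=
  [/\ 0 < L, C1 gamma, forall s, enorm (derive1 gamma s) = 1,
      forall s, gamma (s + L) = gamma s &
      {in `[0, L[ &, injective gamma} /\ gamma @` `[0, L[ = frontier D].

Definition outward_unit_normal {R : realType} (D : set (R * R))
    (gamma : R -> R * R) (nu : R * R -> R * R) : Prop :=
  forall s, let x := gamma s in
    [/\ enorm (nu x) = 1, dot (nu x) (derive1 gamma s) = 0 &
        \forall t \near (0 : R)^'+,
          ~ closure D (x + t *: nu x) /\ D (x - t *: nu x)].

(* Value at gamma s of the arclength derivative of f along the boundary. *)
Definition dtau {R : realType} (gamma : R -> R * R) (f : R * R -> R) (s : R) : R :=
  derive1 (f \o gamma) s.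

Definition dnu {R : realType} (nu : R * R -> R * R) (f : R * R -> R)
    (x : R * R) : R := dot (grad f x) (nu x).

Definition cpow {R : realType} (n : nat) (x : R * R) : complex R :=
  (Complex x.1 x.2) ^+ n.

Definition a_ {R : realType} (n : nat) (x : R * R) : R := complex.Re (cpow n x).

Definition b_ {R : realType} (n : nat) (x : R * R) : R := complex.Im (cpow n x).

(* The index i of Ppoly and Qflux starts at 1. *)
Definition Ppoly {R : realType} (i : nat) : R * R -> R :=
  if odd i then a_ i.+1./2 else b_ i./2.

Definition Qflux {R : realType} (nu : R * R -> R * R) (i : nat) : R * R -> R :=
  dnu nu (Ppoly i).

Definition Gam {R : realType} (x : R * R) : R := (2 * pi)^-1 * ln (enorm x).

Definition dnu_Gam {R : realType} (nu : R * R -> R * R) (x y : R * R) : R :=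
  dnu nu (fun z => Gam (z - y)) x.

(* Principal value of the integral over y of g(y) dGamma(x - y)/dnu_x. *)
Definition pv_dnu_Gam {R : realType} (L : R) (gamma : R -> R * R)
    (nu : R * R -> R * R) (g : R * R -> R) (x : R * R) : R :=
  lim ((fun eps : R =>
    \int[lebesgue_measure]_(t in `[0, L[ `&` [set t | eps < enorm (x - gamma t)])
       (g (gamma t) * dnu_Gam nu x (gamma t))) @ (0 : R)^'+).

(* In the double integrals, x = gamma z.1 and y = gamma z.2. *)
Definition matP {R : realType} (L : R) (gamma : R -> R * R) (np : nat) :
    'M[R]_np :=
  \matrix_(i < np, j < np)
    \int[plane_measure]_(z in `[0, L[ `*` `[0, L[)
      (dtau gamma (Ppoly i.+1) z.2 * dtau gamma (Ppoly j.+1) z.1 *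
       Gam (gamma z.1 - gamma z.2)).

Definition matQ {R : realType} (L : R) (gamma : R -> R * R)
    (nu : R * R -> R * R) (nq : nat) : 'M[R]_nq :=
  \matrix_(i < nq, j < nq)
    \int[plane_measure]_(z in `[0, L[ `*` `[0, L[)
      (Qflux nu j.+1 (gamma z.1) * Qflux nu i.+1 (gamma z.2) *
       Gam (gamma z.1 - gamma z.2)).

Definition matN {R : realType} (L : R) (gamma : R -> R * R)
    (nu : R * R -> R * R) (np nq : nat) : 'M[R]_(np, nq) :=
  \matrix_(i < np, j < nq)
    \int[lebesgue_measure]_(s in `[0, L[)
      (Ppoly i.+1 (gamma s) * pv_dnu_Gam L gamma nu (Qflux nu j.+1) (gamma s)).

Definition matM {R : realType} (L : R) (gamma : R -> R * R)
    (nu : R * R -> R * R) (k : R) (np nq : nat) : 'M[R]_(np + nq) :=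
  block_mx ((k + 1) *: matP L gamma np)
           ((2 * k) *: matN L gamma nu np nq)
           (- 2 *: (matN L gamma nu np nq)^T)
           ((k + 1) *: matQ L gamma nu nq).

Definition symmetric_negdef {R : realType} (n : nat) (A : 'M[R]_n) : Prop :=
  A^T = A /\ forall v : 'cV[R]_n, v != 0 -> (v^T *m A *m v) 0 0 < 0.

(* Main.v *)
Require Import Defs.
From mathcomp Require Import all_boot all_order all_algebra.
From mathcomp Require Import all_classical all_reals all_analysis.
From mathcomp Require Import measurable_realfun complex ring lra.

Set Implicit Arguments.
Unset Strict Implicit.
Unset Printing Implicit Defensive.

Import Order.TTheory GRing.Theory Num.Theory.
Import numFieldNormedType.Exports.

Local Open Scope classical_set_scope.
Local Open Scope ring_scope.

(* diag(1, k) M has the quadratic form (k + 1) p^T P p + k (k + 1) q^T Q q, since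
   the two copies of N cancel; hence M is nonsingular, with a determinant of sign
   (-1)^(np + nq) = 1, as soon as P and Q are negative definite.

   By the Cauchy-Riemann equations, P and Q are Gram matrices, for the kernel
   ln |x - y|, of tangential derivatives f of harmonic polynomials along the
   boundary; such an f has mean zero.  The stereographic kernel
     u(x, y) = |1 + conj(x) y|^2 / ((1 + |x|^2) (1 + |y|^2)) in [0, 1]
   satisfies 1 - u = |x - y|^2 / ((1 + |x|^2) (1 + |y|^2)), so that, f having
   mean zero,
     int int f f ln |x - y|^2 = - sum_(n >= 1) (1 / n) int int f f u^n.
   As u is a finite sum of products phi_i(x) phi_i(y), every term of the series is
   nonnegative, and if all of them vanish then f is orthogonal to the powers
   u(x0, .)^n, which concentrate at x0: hence f = 0.  Finally f = 0 means that the
   harmonic polynomial is constant on the boundary, and by the maximum principle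
   it has degree 0. *)

(** * Integration on the square of a period *)

(** The kernel [u] is the squared cosine of half the angle between the two points of the unit sphere
    that correspond to x and y under stereographic projection. Passing to the sphere makes the
    series of [- ln (1 - u)] available wherever the curve lies, and the conformal factors 1 + |x|^2
    enter the logarithm as summands in one variable, which a density of mean zero does not see. The
    series diverges on the diagonal, so exchanging it with the integral requires ln |x - y| to be
    integrable on the square. This comes from a bound, uniform in the centre, on the length of the
    curve inside a disc of radius r. Q asks for more geometry than P. Orthogonality to the tangent
    only gives nu = +-(rotated tangent) at each point, and if the sign could jump along the curve,
    the flux would no longer be the tangential derivative of one harmonic polynomial. The local
    graphs of the boundary show that the sign is constant. *)

Lemma continuous_exprn (R : realType) (u : R -> R) n : continuous u ->
  continuous (fun t => u t ^+ n).
Proof.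
move=> cu t; elim: n => [|n IH]; first by apply: cvg_cst.
by under eq_fun do rewrite exprS; apply: cvgM => //; exact: cu.
Qed.

Section square.
Context {R : realType} (L : R).
Hypothesis L_gt0 : 0 < L.
Local Notation mu := (@lebesgue_measure R).
Local Notation E := (`[0, L[%classic : set R).
Local Notation EE := (E `*` E).
Local Notation RR := (measurableTypeR R * measurableTypeR R)%type.

Lemma measurable_square : measurable (EE : set RR).
Proof. by apply: measurableX => //; exact: measurable_itv. Qed.

Lemma measurable_period : measurable (E : set (measurableTypeR R)).
Proof. exact: measurable_itv. Qed.

Lemma lebesgue_measure_period : mu E = L%:E.
Proof. by rewrite lebesgue_measure_itv /= lte_fin L_gt0 oppr0 adde0. Qed.

Lemma plane_measure_square : plane_measure EE = (L ^+ 2)%:E.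
Proof.
rewrite (_ : plane_measure EE = mu E * mu E)%E.
  by rewrite lebesgue_measure_period -EFinM expr2.
by rewrite /plane_measure product_measure1E//; exact: measurable_itv.
Qed.

Lemma bounded_integrable_square (F : RR -> R) (B : R) :
  measurable_fun [set: RR] F -> (forall z, EE z -> `|F z| <= B) ->
  (@plane_measure R).-integrable EE (EFin \o F).
Proof.
move=> mF bF; apply: measurable_bounded_integrable.
- exact: measurable_square.
- by rewrite [X in (X < _)%E]plane_measure_square ltry.
- exact: measurable_funTS.
- exists B; split; first exact: num_real.
  by move=> x Bx z /= Ez; exact: le_trans (bF z Ez) (ltW Bx).
Qed.

Lemma continuous_bounded_itv (f : R -> R) : continuous f ->
  exists2 B : R, 0 < B & forall t, E t -> `|f t| <= B.
Proof.
move=> cf.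
have := @continuous_compact R R f `[0, L]%classic (continuous_subspaceT cf) (@segment_compact R 0 L).
move/compact_bounded => [M [_ HM]].
exists (`|M| + 1); first by rewrite ltr_wpDl.
move=> t; rewrite /= in_itv/= => /andP[t0 tL].
apply: (HM (`|M| + 1)); first by rewrite (le_lt_trans (ler_norm _)) ?ltrDl.
by exists t => //=; rewrite in_itv/= t0 ltW.
Qed.

Lemma continuous_integrable_itv (f : R -> R) : continuous f ->
  mu.-integrable E (EFin \o f).
Proof.
move=> cf; have [B B0 HB] := continuous_bounded_itv cf.
apply: measurable_bounded_integrable.
- exact: measurable_itv.
- by rewrite [X in (X < _)%E]lebesgue_measure_period ltry.
- apply: measurable_funTS; exact: continuous_measurable_fun.
- exists B; split; first exact: num_real.
  by move=> x Bx z /= Ez; exact: le_trans (HB z Ez) (ltW Bx).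
Qed.

Lemma measurable_fst_comp (f : measurableTypeR R -> R) : measurable_fun setT f ->
  measurable_fun [set: RR] (fun z : RR => f z.1).
Proof. by move=> mf; apply: measurableT_comp mf _. Qed.

Lemma measurable_snd_comp (f : measurableTypeR R -> R) : measurable_fun setT f ->
  measurable_fun [set: RR] (fun z : RR => f z.2).
Proof. by move=> mf; apply: measurableT_comp mf _. Qed.

Lemma integral_square_iterated (F : RR -> R) :
  measurable_fun [set: RR] F -> (@plane_measure R).-integrable EE (EFin \o F) ->
  (\int[@plane_measure R]_(z in EE) (F z)%:E =
   \int[mu]_x \int[mu]_y ((F \_ EE) (x, y))%:E)%E /\
  (\int[@plane_measure R]_(z in EE) (F z)%:E =
   \int[mu]_y \int[mu]_x ((F \_ EE) (x, y))%:E)%E.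
Proof.
move=> mF iF.
have i' : (mu \x mu)%E.-integrable setT (EFin \o (F \_ EE)).
  by rewrite -restrict_EFin; apply/(integrable_mkcond _ measurable_square).
rewrite integral_mkcond/= restrict_EFin; split.
  by rewrite -(integral12_prod_meas1 i').
by rewrite -(integral21_prod_meas1 i').
Qed.

(** Assumes integrability rather than boundedness of [F], since it serves to prove the symmetry of
    the form with the unbounded logarithmic kernel. *)
Lemma Rintegral_square_swap (F : RR -> R) :
  measurable_fun [set: RR] F -> (@plane_measure R).-integrable EE (EFin \o F) ->
  \int[@plane_measure R]_(z in EE) F (z.2, z.1) =
  \int[@plane_measure R]_(z in EE) F z.
Proof.
move=> mF iF.
have ms : measurable_fun [set: RR] (fun z : RR => (z.2, z.1)).
  exact: measurable_fun_pair.
have mG : measurable_fun [set: RR] (fun z : RR => F (z.2, z.1)).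
  exact: measurableT_comp mF ms.
have rE x y : ((fun z : RR => F (z.2, z.1)) \_ EE) (x, y) = (F \_ EE) (y, x).
  rewrite /patch; congr (if _ then _ else _).
  by apply/idP/idP => /[!inE] /= -[].
have iG : (@plane_measure R).-integrable EE (EFin \o (fun z => F (z.2, z.1))).
  have i' : (mu \x mu)%E.-integrable setT (EFin \o (F \_ EE)).
    by rewrite -restrict_EFin; apply/(integrable_mkcond _ measurable_square).
  apply/(integrable_mkcond _ measurable_square); rewrite restrict_EFin.
  have mG' : measurable_fun [set: RR] (EFin \o ((fun z : RR => F (z.2, z.1)) \_ EE)).
    apply/measurable_EFinP.
    by apply/(measurable_restrictT _ measurable_square); exact: measurable_funTS.
  (* By Tonelli, finiteness of one iterated integral of the absolute value suffices, and exchanging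
     the variables exchanges the two iterated integrals. *)
  apply: (iffRL (@integrable12ltyP _ _ _ _ R mu mu _ mG')).
  have mF' : measurable_fun [set: RR] (EFin \o (F \_ EE)) := measurable_int _ i'.
  have := iffLR (@integrable21ltyP _ _ _ _ R mu mu _ mF') i'.
  by under eq_integral => x _ do
    (under eq_integral => y _ do rewrite /= -rE).
rewrite /Rintegral (integral_square_iterated mG iG).1 (integral_square_iterated mF iF).2.
by have -> : (fun z : RR => F (z.2, z.1)) \_ EE = (F \_ EE) \o (fun z => (z.2, z.1))
  by apply/funext => -[x y]; exact: rE.
Qed.

Lemma Rintegral_square_prod (g h : R -> R) : continuous g -> continuous h ->
  \int[@plane_measure R]_(z in EE) (g z.1 * h z.2) =
  (\int[mu]_(x in E) g x) * (\int[mu]_(x in E) h x).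
Proof.
move=> cg ch.
have [B B0 HB] := continuous_bounded_itv cg.
have [C C0 HC] := continuous_bounded_itv ch.
have mF : measurable_fun [set: RR] (fun z : RR => g z.1 * h z.2).
  by apply: measurable_funM; [apply: measurable_fst_comp|apply: measurable_snd_comp];
    exact: continuous_measurable_fun.
have iF : (@plane_measure R).-integrable EE (EFin \o (fun z => g z.1 * h z.2)).
  apply: (bounded_integrable_square (B := B * C)) => // -[x y] [/= Ex Ey].
  by rewrite normrM ler_pM // ?HB ?HC.
rewrite {1}/Rintegral (integral_square_iterated mF iF).1.
have ig := continuous_integrable_itv cg.
have ih := continuous_integrable_itv ch.
have -> : (fun z : RR => g z.1 * h z.2) \_ EE = fun z => (g \_ E) z.1 * (h \_ E) z.2.
  apply/funext => -[x y]; rewrite /patch in_setX /=.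
  by case: (x \in _) => /=; case: (y \in _); rewrite ?mul0r ?mulr0.
have restr_int f : mu.-integrable E (EFin \o f) -> mu.-integrable setT (EFin \o (f \_ E)).
  by rewrite -restrict_EFin => /(integrable_mkcond _ measurable_period).
rewrite [X in _ = X * _]Rintegral_mkcond [X in _ = _ * X]Rintegral_mkcond.
rewrite /Rintegral -fineM; [|exact: integrable_fin_num (restr_int _ _)..].
congr fine.
have fh : (\int[mu]_x ((h \_ E) x)%:E)%E \is a fin_num.
  exact: integrable_fin_num (restr_int _ _).
rewrite -(fineK fh) -integralZr//; last exact: restr_int.
apply: eq_integral => x _; rewrite fineK// -integralZl//; exact: restr_int.
Qed.

End square.

(** * Separable kernels *)

Section Rintegral_sum.
Context d (T : measurableType d) (R : realType) (m : {measure set T -> \bar R}).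
Context (D : set T) (mD : measurable D) (I : Type) (K : I -> T -> R).
Hypothesis iK : forall i, m.-integrable D (EFin \o K i).

Lemma integrable_Rsum (r : seq I) :
  m.-integrable D (EFin \o (fun z => \sum_(i <- r) K i z)).
Proof.
have := @integrable_sum _ _ _ m D mD I r xpredT (fun i => EFin \o K i).
move=> /(_ (fun i _ => iK i)); apply: eq_integrable => // z _ /=.
by rewrite sumEFin.
Qed.

Lemma Rintegral_sum (r : seq I) :
  \int[m]_(z in D) (\sum_(i <- r) K i z) =
  \sum_(i <- r) \int[m]_(z in D) K i z.
Proof.
elim: r => [|i r IH].
  rewrite big_nil; under eq_Rintegral do rewrite big_nil.
  by rewrite Rintegral_cst// mul0r.
under eq_Rintegral do rewrite big_cons.
by rewrite big_cons RintegralD// ?IH//; exact: integrable_Rsum.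
Qed.

End Rintegral_sum.

Section kernel.
Context {R : realType} (L : R).
Hypothesis L_gt0 : 0 < L.
Local Notation mu := (@lebesgue_measure R).
Local Notation E := (`[0, L[%classic : set R).
Local Notation EE := (E `*` E).
Local Notation RR := (measurableTypeR R * measurableTypeR R)%type.
Local Notation pm := (@plane_measure R).

(** These functions form an algebra, and the square has finite measure: integrability of the
    polynomial expressions below follows from closure properties. *)
Definition bounded_kernel (K : RR -> R) :=
  measurable_fun [set: RR] K /\ exists B, forall z, EE z -> `|K z| <= B.

Lemma bounded_kernel_integrable (K : RR -> R) : bounded_kernel K ->
  pm.-integrable EE (EFin \o K).
Proof. by move=> [mK [B HB]]; exact: bounded_integrable_square HB. Qed.

Lemma bounded_kernel_fst (f : R -> R) : continuous f ->
  bounded_kernel (fun z => f z.1).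
Proof.
move=> cf; split.
  by apply: measurable_fst_comp; exact: continuous_measurable_fun.
have [B _ HB] := continuous_bounded_itv L cf.
by exists B => z [+ _]; exact: HB.
Qed.

Lemma bounded_kernel_snd (f : R -> R) : continuous f ->
  bounded_kernel (fun z => f z.2).
Proof.
move=> cf; split.
  by apply: measurable_snd_comp; exact: continuous_measurable_fun.
have [B _ HB] := continuous_bounded_itv L cf.
by exists B => z [_ +]; exact: HB.
Qed.

Lemma bounded_kernel_cst (c : R) : bounded_kernel (fun=> c).
Proof. by split; [exact: measurable_cst|exists `|c|]. Qed.

Lemma bounded_kernelD (K1 K2 : RR -> R) :
  bounded_kernel K1 -> bounded_kernel K2 ->
  bounded_kernel (fun z => K1 z + K2 z).
Proof.
move=> [m1 [B1 H1]] [m2 [B2 H2]]; split; first exact: measurable_funD.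
exists (B1 + B2) => z Ez.
by rewrite (le_trans (ler_normD _ _))// lerD ?H1 ?H2.
Qed.

Lemma bounded_kernelM (K1 K2 : RR -> R) :
  bounded_kernel K1 -> bounded_kernel K2 ->
  bounded_kernel (fun z => K1 z * K2 z).
Proof.
move=> [m1 [B1 H1]] [m2 [B2 H2]]; split; first exact: measurable_funM.
by exists (B1 * B2) => z Ez; rewrite normrM ler_pM ?H1 ?H2.
Qed.

Lemma bounded_kernelX (K : RR -> R) n :
  bounded_kernel K -> bounded_kernel (fun z => K z ^+ n).
Proof.
move=> bK; elim: n => [|n IH].
  by under eq_fun do rewrite expr0; exact: bounded_kernel_cst.
by under eq_fun do rewrite exprS; exact: bounded_kernelM.
Qed.

Lemma bounded_kernel_sum (I : Type) (r : seq I) (K : I -> RR -> R) :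
  (forall i, bounded_kernel (K i)) ->
  bounded_kernel (fun z => \sum_(i <- r) K i z).
Proof.
move=> bK; elim: r => [|i r IH].
  by under eq_fun do rewrite big_nil; exact: bounded_kernel_cst.
by under eq_fun do rewrite big_cons; exact: bounded_kernelD.
Qed.

Section separable.
Context (I : finType) (phi : I -> R -> R).
Hypothesis cphi : forall i, continuous (phi i).

Definition sep_kernel (s t : R) : R := \sum_i phi i s * phi i t.

Lemma bounded_sep_kernel : bounded_kernel (fun z => sep_kernel z.1 z.2).
Proof.
apply: bounded_kernel_sum => i.
by apply: bounded_kernelM; [exact: bounded_kernel_fst|exact: bounded_kernel_snd].
Qed.

Definition energy (n : nat) (f : R -> R) : R :=
  \int[pm]_(z in EE) (f z.1 * f z.2 * sep_kernel z.1 z.2 ^+ n).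

Lemma bounded_kernel_energy n (f : R -> R) : continuous f ->
  bounded_kernel (fun z => f z.1 * f z.2 * sep_kernel z.1 z.2 ^+ n).
Proof.
move=> cf; apply: bounded_kernelM; last exact/bounded_kernelX/bounded_sep_kernel.
by apply: bounded_kernelM; [exact: bounded_kernel_fst|exact: bounded_kernel_snd].
Qed.

Lemma continuous_mul_phi (f : R -> R) i : continuous f ->
  continuous (fun t => f t * phi i t).
Proof. by move=> cf t; apply: continuousM; [exact: cf|exact: cphi]. Qed.

(** Expanding a single factor of the kernel moves [phi i] into the density, in both variables at
    once. This is the Schur product theorem, one factor at a time. *)
Lemma energyS n (f : R -> R) : continuous f ->
  energy n.+1 f = \sum_i energy n (fun t => f t * phi i t).
Proof.
move=> cf; rewrite /energy -Rintegral_sum; [|exact: measurable_square|]; last first.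
  move=> i; apply: bounded_kernel_integrable.
  exact: (bounded_kernel_energy n (@continuous_mul_phi f i cf)).
apply: eq_Rintegral => z _ /=.
rewrite exprS mulrA {1}/sep_kernel mulr_sumr mulr_suml.
by apply: eq_bigr => i _; ring.
Qed.

Lemma energy_ge0 n (f : R -> R) : continuous f -> 0 <= energy n f.
Proof.
elim: n f => [|n IH] f cf.
  rewrite /energy; under eq_Rintegral do rewrite expr0 mulr1.
  by rewrite Rintegral_square_prod// -expr2 sqr_ge0.
by rewrite energyS// sumr_ge0// => i _; exact: IH (@continuous_mul_phi f i cf).
Qed.

(** A vanishing sum of nonnegative energies has vanishing terms. The condition on all [n] is thus
    inherited by [f * phi i], which lets the next induction run over all densities. *)
Lemma energy_eq0_mul (f : R -> R) i : continuous f -> (forall n, energy n f = 0) ->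
  forall n, energy n (fun t => f t * phi i t) = 0.
Proof.
move=> cf f0 n; apply/eqP.
have := f0 n.+1; rewrite energyS// => /eqP.
rewrite psumr_eq0; last by move=> j _; exact: energy_ge0 (@continuous_mul_phi f j cf).
by move=> /allP/(_ i); rewrite mem_index_enum => /(_ isT).
Qed.

Lemma continuous_sep_kernel s : continuous (sep_kernel s).
Proof.
rewrite /sep_kernel; elim: (index_enum I) => [|i r IH] t.
  by under eq_fun do rewrite big_nil; exact: cvg_cst.
under eq_fun do rewrite big_cons.
by apply: cvgD; [apply: cvgM; [exact: cvg_cst|exact: cphi]|exact: IH].
Qed.

(** At [n = 0] the energy is the square of the integral of [f]; each further factor [sep_kernel s]
    splits into the densities [f * phi i], whose energies vanish too. *)
Lemma energy_eq0_moment s (f : R -> R) : continuous f -> (forall n, energy n f = 0) ->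
  forall n, \int[mu]_(t in E) (f t * sep_kernel s t ^+ n) = 0.
Proof.
move=> cf f0 n; elim: n f cf f0 => [|n IH] f cf f0.
  under eq_Rintegral do rewrite expr0 mulr1.
  have := f0 0%N; rewrite /energy.
  under eq_Rintegral do rewrite expr0 mulr1.
  by rewrite Rintegral_square_prod// => /eqP; rewrite mulf_eq0 orbb => /eqP.
transitivity (\int[mu]_(t in E) (\sum_i phi i s * ((f t * phi i t) * sep_kernel s t ^+ n))).
  apply: eq_Rintegral => t _; rewrite exprS mulrA {1}/sep_kernel mulr_sumr mulr_suml.
  by apply: eq_bigr => i _; ring.
have ci i : mu.-integrable E (EFin \o (fun t => (f t * phi i t) * sep_kernel s t ^+ n)).
  apply: continuous_integrable_itv => // t; apply: cvgM; last exact: (@continuous_exprn R _ n (@continuous_sep_kernel s)).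
  exact: continuous_mul_phi.
rewrite Rintegral_sum; [|exact: measurable_period|by move=> i; exact: (integrableZl (measurable_period L) (phi i s) (ci i))].
rewrite big1// => i _; rewrite RintegralZl//.
rewrite IH ?mulr0//; first exact: continuous_mul_phi.
exact: energy_eq0_mul.
Qed.

End separable.
End kernel.

(** * The power series of the logarithm *)

Section log_series.
Context {R : realType}.

Lemma ge0_of_derive_ge0 (f df : R -> R) (x : R) : 0 <= x -> f 0 = 0 ->
  (forall y, 0 <= y <= x -> is_derive y (1 : R) f (df y)) ->
  (forall y, 0 <= y <= x -> 0 <= df y) -> 0 <= f x.
Proof.
move=> x0 f0 fdf df0.
have [||y yx] := @MVT_segment R f df 0 x x0.
- by move=> y /[!in_itv]/= /andP[/ltW ? /ltW ?]; apply: fdf; apply/andP.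
- apply: derivable_within_continuous => y /[!in_itv]/= yx.
  by have := fdf y yx; exact: @ex_derive.
by rewrite f0 !subr0 => ->; rewrite mulr_ge0// df0.
Qed.

(** Its derivative is the remainder x^m / (1 - x) of the geometric series, which has an evident
    sign. *)
Definition log_remainder (m : nat) (x : R) : R :=
  - ln (1 - x) - \sum_(n < m) x ^+ n.+1 / n.+1%:R.

Lemma log_remainderS m : log_remainder m.+1 =
  (fun x => log_remainder m x - x ^+ m.+1 / m.+1%:R).
Proof. by apply/funext => x; rewrite /log_remainder big_ord_recr/= opprD addrA. Qed.

Lemma log_remainder0 m : log_remainder m 0 = 0.
Proof.
rewrite /log_remainder subr0 ln1 oppr0 sub0r big1 ?oppr0// => i _.
by rewrite expr0n mul0r.
Qed.

Lemma is_derive_log1B (y : R) : y < 1 ->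
  is_derive y (1 : R) (fun x => - ln (1 - x)) (1 - y)^-1.
Proof.
move=> y1.
have h : 0 < 1 - y by rewrite subr_gt0.
have d1 := is_derive1_ln h.
apply: is_derive_eq.
by rewrite /GRing.scale/=; ring.
Qed.

Lemma is_derive_exprn n (y : R) :
  is_derive y (1 : R) (fun x => x ^+ n) (n%:R * y ^+ n.-1).
Proof.
have := @is_deriveX R R id n y 1 1 (is_derive_id _ _).
by rewrite fctE /GRing.scale /= mulr1.
Qed.

Lemma is_derive_log_remainder m (y : R) : y < 1 ->
  is_derive y (1 : R) (log_remainder m) (y ^+ m / (1 - y)).
Proof.
move=> y1; have y1' : 1 - y != 0 by rewrite subr_eq0 gt_eqF.
elim: m => [|m IH].
  rewrite expr0 mul1r (_ : log_remainder 0 = fun x => - ln (1 - x)).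
    exact: is_derive_log1B.
  by apply/funext => x; rewrite /log_remainder big_ord0 subr0.
have d1 := is_derive_exprn m.+1 y.
have d2 := is_deriveB IH (is_deriveM d1 (is_derive_cst (m.+1%:R^-1 : R) y 1)).
rewrite log_remainderS; apply: (is_derive_eq d2).
rewrite /GRing.scale/= exprS; field.
by rewrite y1' nat1r pnatr_eq0.
Qed.

Lemma log_remainder_ge0 m (x : R) : 0 <= x < 1 -> 0 <= log_remainder m x.
Proof.
move=> /andP[x0 x1]; apply: (ge0_of_derive_ge0 x0 (log_remainder0 m)).
  by move=> y /andP[y0 yx]; apply: is_derive_log_remainder; exact: le_lt_trans x1.
move=> y /andP[y0 yx]; rewrite divr_ge0 ?exprn_ge0// subr_ge0.
by rewrite ltW// (le_lt_trans yx).
Qed.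

(** The terms y^m / (1 - y) cancel in the derivative of the difference of the two sides, leaving m
    y^(m-1) (- ln (1 - y)) >= 0. The factor x^m forces the remainder to 0. *)
Lemma log_remainder_le m (x : R) : 0 <= x < 1 ->
  log_remainder m x <= x ^+ m * - ln (1 - x).
Proof.
move=> /andP[x0 x1]; rewrite -subr_ge0.
apply: (@ge0_of_derive_ge0 (fun x => x ^+ m * - ln (1 - x) - log_remainder m x)
  (fun y => m%:R * y ^+ m.-1 * - ln (1 - y)) x x0).
- by rewrite log_remainder0 !subr0 ln1 oppr0 mulr0.
- move=> y /andP[y0 yx]; have y1 := le_lt_trans yx x1.
  have d1 := is_derive_log1B y1; have d2 := is_derive_log_remainder m y1.
  apply: (is_derive_eq (is_deriveB (is_deriveM (is_derive_exprn m y) d1) d2)).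
  by rewrite /GRing.scale/= -mulr_natl; ring.
- move=> y /andP[y0 yx]; rewrite !mulr_ge0 ?exprn_ge0// oppr_ge0 ln_le0//.
  by rewrite lerBlDr lerDl.
Qed.

Lemma cvg_log_series (x : R) : 0 <= x < 1 ->
  (\sum_(n < m) x ^+ n.+1 / n.+1%:R) @[m --> \oo] --> - ln (1 - x).
Proof.
move=> x01; have /andP[x0 x1] := x01.
have c0 : log_remainder^~ x @ \oo --> (0 : R).
  apply: (@squeeze_cvgr _ _ _ _ (fun=> 0) (fun m => x ^+ m * - ln (1 - x))).
  - by apply: nearW => m; rewrite log_remainder_ge0// log_remainder_le.
  - exact: cvg_cst.
  - rewrite -[X in _ --> X](mul0r (- ln (1 - x))); apply: cvgMl.
    by apply: cvg_expr; rewrite ger0_norm.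
rewrite (_ : (fun m => _) = fun m => - ln (1 - x) - log_remainder m x).
  by rewrite -[X in _ --> X]subr0; apply: cvgB => //; exact: cvg_cst.
by apply/funext => m; rewrite /log_remainder opprB addrC subrK.
Qed.

Lemma log_partial_sum_le m (x : R) : 0 <= x < 1 ->
  \sum_(n < m) x ^+ n.+1 / n.+1%:R <= - ln (1 - x).
Proof. by move=> /(log_remainder_ge0 m); rewrite subr_ge0. Qed.

End log_series.

(** * Powers of a peak function *)

Section peak.
Context {R : realType} (L : R).
Hypothesis L_gt0 : 0 < L.
Local Notation mu := (@lebesgue_measure R).
Local Notation E := (`[0, L[%classic : set R).

Lemma continuous_gt_near (g : R -> R) (s c : R) : {for s, continuous g} -> c < g s ->
  exists2 d : R, 0 < d & forall t, `|t - s| < d -> c < g t.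
Proof.
move=> cg cs.
have : \forall t \near s, c < g t by move: c cs; exact: (cvgr_gt _ cg).
move=> /nbhs_ballP[d /= d0 Hd]; exists d => // t td.
by apply: Hd; rewrite /ball/= distrC.
Qed.

(** Laplace's method: the part of the integral near [s] is at least of order [th'^n], and what can
    be negative is at most of order [th^n], with [th < th' < 1]. *)
Lemma peak_contra (f u : R -> R) (s : R) : continuous f -> continuous u ->
  0 < s < L -> 0 < f s -> u s = 1 ->
  (forall t, 0 <= t <= L -> 0 <= u t) ->
  (forall t, 0 <= t <= L -> t != s -> u t < 1) ->
  (forall n, \int[mu]_(t in E) (f t * u t ^+ n) = 0) -> False.
Proof.
move=> cf cu /andP[s0 sL] fs us u0 u1 I0.
have fs2 : f s / 2 < f s by lra.
have [d1 d10 Hd1] := continuous_gt_near (cf s) fs2.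
set c := f s / 2 in Hd1; have c0 : 0 < c by rewrite /c; lra.
pose d := Num.min d1 (Num.min s (L - s)).
have d0 : 0 < d by rewrite /d !lt_min d10 s0 subr_gt0 sL.
have dd1 : d <= d1 by rewrite /d ge_min lexx.
have ds : d <= s by rewrite /d !ge_min lexx orbT.
have dL : d <= L - s by rewrite /d !ge_min lexx !orbT.
(* Compactness makes [u < 1] uniform away from [s]: a maximum is taken on each of the two closed
   segments outside the gap of radius [d]. *)
have [||t1 t1i Ht1] := @EVT_max R u 0 (s - d).
- by rewrite subr_ge0.
- exact: continuous_subspaceT.
have [||t2 t2i Ht2] := @EVT_max R u (s + d) L.
- lra.
- exact: continuous_subspaceT.
move: t1i t2i; rewrite !in_itv/= => /andP[t10 t1s] /andP[t2s t2L].
pose th := Num.max (u t1) (u t2).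
have th1 : th < 1.
  rewrite /th gt_max; apply/andP; split; apply: u1; try (by apply/andP; split; lra).
    by rewrite lt_eqF//; lra.
  by rewrite gt_eqF//; lra.
have th0 : 0 <= th by rewrite /th le_max u0//; apply/andP; split; lra.
have thP t : 0 <= t <= L -> d <= `|t - s| -> u t <= th.
  move=> /andP[t0 tL]; rewrite /th le_max ler_normr => /orP[h|h].
    by rewrite [u t <= u t2]Ht2 ?orbT// in_itv/= tL andbT; lra.
  by rewrite [u t <= u t1]Ht1// in_itv/= t0/=; lra.
pose th' := (th + 1) / 2.
have thth' : th < th' by rewrite /th'; lra.
have th'0 : 0 < th' by rewrite /th'; lra.
have [|e1 e10 He1] := @continuous_gt_near u s th' (cu s).
  by rewrite us /th'; lra.
pose e := Num.min e1 d.
have e0 : 0 < e by rewrite /e lt_min e10 d0.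
have ee1 : e <= e1 by rewrite /e ge_min lexx.
have ed : e <= d by rewrite /e ge_min lexx orbT.
have [B B0 HB] := continuous_bounded_itv L cf.
pose J := (`]s - e, s + e[%classic : set R).
have mJ : measurable (J : set (measurableTypeR R)) by exact: measurable_itv.
have JE : J `<=` E.
  by move=> t; rewrite /J /= !in_itv/= => /andP[? ?]; apply/andP; split; lra.
have muJ : mu J = (e *+ 2)%:E.
  rewrite /J lebesgue_measure_itv/= lte_fin ifT; last by lra.
  by rewrite -EFinB; congr EFin; rewrite mulr2n; lra.
(* On [J] both factors are bounded below; between [e] and [d] the integrand is merely nonnegative;
   beyond [d] its absolute value is at most [B * th ^+ n]. *)
have lb n t : E t -> c * th' ^+ n * \1_J t - B * th ^+ n <= f t * u t ^+ n.
  move=> Et; have /andP[t0 tL] : 0 <= t <= L.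
    by move: Et; rewrite /= in_itv/= => /andP[-> /ltW].
  have ut0 : 0 <= u t by rewrite u0// t0 tL.
  have Bth : 0 <= B * th ^+ n by rewrite mulr_ge0 ?exprn_ge0// ltW.
  rewrite indicE; have [|] := boolP (t \in J).
    rewrite inE /J /= in_itv/= => /andP[h1 h2]; rewrite mulr1.
    have tse : `|t - s| < e by rewrite ltr_norml; apply/andP; split; lra.
    rewrite (@le_trans _ _ (c * th' ^+ n))//; first by rewrite lerBlDr lerDl.
    rewrite ler_pM ?exprn_ge0 ?(ltW c0) ?(ltW th'0)//.
      by rewrite ltW// Hd1//; lra.
    by rewrite lerXn2r ?nnegrE ?(ltW th'0)// ltW// He1//; lra.
  move=> tJ; rewrite mulr0 sub0r.
  have [tsd|tsd] := ltP `|t - s| d.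
    rewrite (@le_trans _ _ 0) ?oppr_le0// mulr_ge0 ?exprn_ge0//.
    by rewrite (le_trans (ltW c0))// ltW// Hd1//; lra.
  rewrite lerNl (le_trans (ler_norm _))// normrN normrM ler_pM ?HB//.
  rewrite ger0_norm ?exprn_ge0// lerXn2r ?nnegrE// thP//; exact/andP.
have main n : c * th' ^+ n * (e *+ 2) <= B * th ^+ n * L.
  have iJ : mu.-integrable E (EFin \o (\1_J : R -> R)).
    apply: (integrableS measurableT (measurable_period L)) => //.
    exact: integrable_indic_itv.
  have i1 : mu.-integrable E (EFin \o (fun t => c * th' ^+ n * \1_J t)).
    exact: (integrableZl (measurable_period L) (c * th' ^+ n) iJ).
  have i2 : mu.-integrable E (EFin \o (fun=> B * th ^+ n)).
    by apply: continuous_integrable_itv => //; exact: cst_continuous.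
  have i3 : mu.-integrable E (EFin \o (fun t => f t * u t ^+ n)).
    apply: continuous_integrable_itv => // t; apply: cvgM; first exact: cf.
    exact: continuous_exprn cu t.
  have := le_Rintegral (measurable_period L) (integrableB (measurable_period L) i1 i2) i3 (lb n).
  rewrite I0 RintegralB// RintegralZl// Rintegral_cst//.
  rewrite [X in _ - _ * fine X]lebesgue_measure_period//=.
  have -> : \int[mu]_(x in E) (\1_J x : R) = e *+ 2.
    transitivity (fine (mu J)); last by rewrite muJ.
    by rewrite /Rintegral integral_indic// setIidl.
  by rewrite subr_le0.
have : (fun n => (th / th') ^+ n) @ \oo --> (0 : R).
  apply: cvg_expr; rewrite ger0_norm; last by rewrite divr_ge0// ltW.
  by rewrite ltr_pdivrMr// mul1r.
move=> /cvgrPdist_lt/(_ (c * (e *+ 2) / (B * L))).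
have BL : 0 < B * L by rewrite mulr_gt0.
have -> : 0 < c * (e *+ 2) / (B * L) by rewrite divr_gt0// mulr_gt0// mulrn_wgt0.
move=> /(_ isT)[n _ /(_ n (leqnn n))] /=.
rewrite sub0r normrN ger0_norm; last by rewrite exprn_ge0// divr_ge0// ltW.
rewrite expr_div_n ltr_pdivrMr ?exprn_gt0// ltNge => /negP; apply.
rewrite mulrAC ler_pdivrMr// mulrAC (le_trans (main n))//.
by rewrite mulrAC mulrC.
Qed.

End peak.

(** * Integrability of the logarithmic kernel *)

(** Compactness of a segment as an induction: near each [c] the property moves rightwards between
    any two points, and the supremum of the points reached must be [L]. It turns local statements
    about the curve into global ones. *)
Lemma real_induction (R : realType) (L : R) (P : R -> Prop) : 0 <= L -> P 0 ->
  (forall c, 0 <= c <= L -> exists2 d, 0 < d &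
    forall a b, 0 <= a -> a <= b -> c - d < a -> b < c + d -> P a -> P b) ->
  P L.
Proof.
move=> L0 P0 step.
pose S := [set b | 0 <= b <= L /\ P b].
have hS : has_sup S.
  split; first by exists 0; split => //; rewrite lexx L0.
  by exists L => b [/andP[]].
have S0 : S 0 by split => //; rewrite lexx.
have c0 : 0 <= sup S by apply: ub_le_sup S0; exact: hS.2.
have cL : sup S <= L by apply: ge_sup => [|b [/andP[]]//]; exact: hS.1.
have [|d d0 Hd] := step (sup S); first by rewrite c0.
have [a [/andP[a0 aL] Pa] ca] := sup_adherent d0 hS.
have ac : a <= sup S by apply: ub_le_sup; [exact: hS.2|split => //; rewrite a0].
have [Lcd|cdL] := ltP L (sup S + d); first by apply: (Hd a L).
have Pb : P (sup S + d / 2) by apply: (Hd a) => //; lra.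
have : sup S + d / 2 <= sup S.
  by apply: ub_le_sup; [exact: hS.2|split => //; apply/andP; split; lra].
by move=> ?; lra.
Qed.

Section curve.
Context {R : realType} (L : R).
Hypothesis L_gt0 : 0 < L.
Local Notation mu := (@lebesgue_measure R).
Local Notation E := (`[0, L[%classic : set R).
Local Notation EE := (E `*` E).
Local Notation RR := (measurableTypeR R * measurableTypeR R)%type.
Local Notation pm := (@plane_measure R).
Context (g1 g2 dg1 dg2 : R -> R).
Hypothesis g1P : forall s, is_derive s (1 : R) g1 (dg1 s).
Hypothesis g2P : forall s, is_derive s (1 : R) g2 (dg2 s).
Hypothesis dg1c : continuous dg1.
Hypothesis dg2c : continuous dg2.
Hypothesis unit_speed : forall s, dg1 s ^+ 2 + dg2 s ^+ 2 = 1.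

Definition sqdist (x : R * R) (t : R) : R := (x.1 - g1 t) ^+ 2 + (x.2 - g2 t) ^+ 2.

Lemma continuous_of_is_derive (f df : R -> R) :
  (forall s, is_derive s (1 : R) f (df s)) -> continuous f.
Proof.
move=> fP s; apply: differentiable_continuous; apply/derivable1_diffP.
by have := fP s; exact: @ex_derive.
Qed.

Let g1c := continuous_of_is_derive g1P.
Let g2c := continuous_of_is_derive g2P.

Lemma continuous_sqdist x : continuous (sqdist x).
Proof.
move=> t; rewrite /sqdist; apply: cvgD.
  apply: (@continuous_exprn R (fun t => x.1 - g1 t) 2) => {}t.
  by apply: cvgB; [exact: cvg_cst|exact: g1c].
apply: (@continuous_exprn R (fun t => x.2 - g2 t) 2) => {}t.
by apply: cvgB; [exact: cvg_cst|exact: g2c].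
Qed.

(** The component of the curve along its tangent at [c] has derivative 1 at [c], hence more than 1/2
    nearby. The constant 4 is the inverse square of 1/2. *)
Lemma local_bilipschitz (c : R) : exists2 d, 0 < d &
  forall s t, `|s - c| < d -> `|t - c| < d ->
    (s - t) ^+ 2 <= 4 * ((g1 s - g1 t) ^+ 2 + (g2 s - g2 t) ^+ 2).
Proof.
pose h s := dg1 c * g1 s + dg2 c * g2 s.
pose dh s := dg1 c * dg1 s + dg2 c * dg2 s.
have hP s : is_derive s (1 : R) h (dh s).
  have := is_deriveD (is_deriveZ (dg1 c) (g1P s)) (is_deriveZ (dg2 c) (g2P s)).
  exact.
have dhc : {for c, continuous dh}.
  by apply: cvgD; apply: cvgM; [exact: cvg_cst|exact: dg1c|exact: cvg_cst|exact: dg2c].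
have [|d d0 Hd] := @continuous_gt_near R dh c (1 / 2) dhc.
  by rewrite /dh -!expr2 unit_speed; lra.
exists d => // s t; wlog st : s t / t <= s.
  move=> H sc tc; have [/H|/ltW/H] := leP t s; first exact.
  by move=> /(_ tc sc); congr (_ <= _); ring.
move=> sc tc.
have [|u /[!in_itv]/= /andP[tu us] hst] := @MVT_segment R h dh t s st (fun x _ => hP x).
  exact/continuous_subspaceT/(continuous_of_is_derive hP).
have du : 1 / 2 < dh u.
  by apply: Hd; move: sc tc; rewrite !ltr_norml => /andP[? ?] /andP[? ?]; apply/andP; split; lra.
have hst2 : (s - t) / 2 <= h s - h t by rewrite hst; nra.
(* Cauchy-Schwarz against the unit tangent at [c], through Lagrange's identity. *)
have CS : (h s - h t) ^+ 2 <= (g1 s - g1 t) ^+ 2 + (g2 s - g2 t) ^+ 2.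
  rewrite -[leRHS]mul1r -(unit_speed c) -subr_ge0 /h.
  rewrite [leRHS](_ : _ = (dg1 c * (g2 s - g2 t) - dg2 c * (g1 s - g1 t)) ^+ 2).
    exact: sqr_ge0.
  ring.
have : ((s - t) / 2) ^+ 2 <= (h s - h t) ^+ 2.
  by rewrite lerXn2r ?nnegrE//; lra.
rewrite expr_div_n; lra.
Qed.

Definition sublevel x (a b r : R) : set R :=
  `[a, b[ `&` [set t | sqdist x t < r].

Lemma measurable_sublevel x (a b r : R) :
  measurable (sublevel x a b r : set (measurableTypeR R)).
Proof.
rewrite /sublevel.
apply: measurableI; first exact: measurable_itv.
apply: open_measurable.
rewrite (_ : [set t | _] = sqdist x @^-1` [set y | y < r]) //.
apply: open_comp; last exact: open_lt.
by move=> t _; exact: continuous_sqdist.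
Qed.

(** Two points in a disc of radius [r] are less than [2 * r] apart, so on a bi-Lipschitz piece their
    parameters differ by at most [4 * r]. Each piece therefore adds at most [8 * r], whatever the
    centre [x]. *)
Lemma measure_sublevel : exists2 C, 0 <= C & forall x (r : R), 0 < r ->
  (mu (sublevel x 0 L (r ^+ 2)%R) <= (C * r)%:E)%E.
Proof.
apply: (@real_induction R L (fun b => exists2 C, 0 <= C & forall x (r : R), 0 < r ->
  (mu (sublevel x 0 b (r ^+ 2)%R) <= (C * r)%:E)%E)).
- exact: ltW.
- by exists 0 => // x r r0; rewrite /sublevel set_itvco0 set0I measure0 mul0r.
move=> c _; have [d d0 Hd] := local_bilipschitz c; exists d => // a b a0 ab ca bc.
move=> [C C0 HC]; exists (C + 8); first lra.
move=> x r r0.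
apply: (@le_trans _ _ (mu (sublevel x 0 a (r ^+ 2)%R `|` sublevel x a b (r ^+ 2)%R))).
  apply: le_measure; rewrite ?inE.
  - exact: measurable_sublevel.
  - by apply: measurableU; exact: measurable_sublevel.
  move=> t [/= /[!in_itv]/= /andP[t0 tb] tr].
  have [ta|at_] := ltP t a; [left|right]; split => //=; rewrite in_itv/= ?t0 ?at_//.
apply: le_trans; first by apply: measureU2; exact: measurable_sublevel.
rewrite mulrDl EFinD; apply: leeD; first exact: HC.
have [->|/set0P[t0 [/= t0ab t0r]]] := eqVneq (sublevel x a b (r ^+ 2)) set0.
  by rewrite measure0 lee_fin mulr_ge0// ltW.
apply: (@le_trans _ _ (mu (`[t0 - 4 * r, t0 + 4 * r]%classic : set R))); last first.
  rewrite lebesgue_measure_itv/= lte_fin ifT; last by lra.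
  by rewrite -EFinB lee_fin; lra.
apply: le_measure; rewrite ?inE.
- exact: measurable_sublevel.
- exact: measurable_itv.
move=> t [/= tab tr].
have Bl : (t - t0) ^+ 2 <= 4 * ((g1 t - g1 t0) ^+ 2 + (g2 t - g2 t0) ^+ 2).
  by apply: Hd; move: tab t0ab; rewrite !in_itv/= !ltr_norml => /andP[? ?] /andP[? ?];
    apply/andP; split; lra.
have : (t - t0) ^+ 2 <= (4 * r) ^+ 2.
  apply: (le_trans Bl); move: tr t0r; rewrite /sqdist => tr t0r.
  (* These two squares give |a - b|^2 <= 2 |a|^2 + 2 |b|^2 for the vectors from the two curve points
     to [x]. *)
  have h1 := sqr_ge0 ((x.1 - g1 t) + (x.1 - g1 t0)).
  have h2 := sqr_ge0 ((x.2 - g2 t) + (x.2 - g2 t0)).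
  nra.
by move=> tt0; rewrite in_itv/=; apply/andP; split; rewrite leNgt; apply/negP => ?; nra.
Qed.

End curve.

Section log_integrable.
Context {R : realType} (L : R).
Hypothesis L_gt0 : 0 < L.
Local Notation mu := (@lebesgue_measure R).
Local Notation E := (`[0, L[%classic : set R).
Local Notation EE := (E `*` E).
Local Notation RR := (measurableTypeR R * measurableTypeR R)%type.
Local Notation pm := (@plane_measure R).
Context (K : RR -> R) (C : R).
Hypothesis K_ge0 : forall z, 0 <= K z.
Hypothesis bK : bounded_kernel L K.
Hypothesis C_ge0 : 0 <= C.
Hypothesis sublevelK : forall s (r : R), 0 < r ->
  (mu (E `&` [set t | K (s, t) < r ^+ 2]%R) <= (C * r)%:E)%E.

Lemma measurable_sublevel2 (r : R) : measurable (EE `&` [set z | K z < r] : set RR).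
Proof.
apply: measurableI; first exact: measurable_square.
rewrite -[X in measurable X]setTI.
have := bK.1 measurableT `]-oo, r[%classic (measurable_itv _).
congr (measurable _); apply/seteqP; split => z /=; rewrite in_itv//=.
Qed.

Lemma measure_sublevel2 (r : R) : 0 < r ->
  (pm (EE `&` [set z | (K z < r ^+ 2)%R]) <= (L * C * r)%:E)%E.
Proof.
move=> r0; have mS := measurable_sublevel2 (r ^+ 2).
rewrite /plane_measure /product_measure1.
apply: (@le_trans _ _ (\int[mu]_x ((cst (C * r) : R -> R) \_ E x)%:E)%E).
  apply: ge0_le_integral => //.
  - exact: measurable_fun_xsection.
  - by apply/measurable_EFinP/(measurable_restrictT _ (measurable_period L)).
  move=> x _; rewrite /= /patch; case: ifPn => [/[!inE] xE|xE].
    rewrite (_ : xsection _ _ = E `&` [set t | K (x, t) < r ^+ 2]%R).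
      exact: sublevelK.
    apply/seteqP; split => t; rewrite /xsection /= inE.
      by move=> [[_ ?] ?].
    by move=> [? ?].
  rewrite (_ : xsection _ _ = set0) ?measure0//.
  apply/seteqP; split => // t; rewrite /xsection /= inE => -[[xE' _] _].
  by move: xE; rewrite notin_setE.
rewrite [leLHS](_ : _ = \int[mu]_(x in E) (C * r)%:E)%E; last first.
  by rewrite [RHS]integral_mkcond; apply: eq_integral => x _; rewrite /patch; case: ifP.
rewrite integral_cst//=.
by rewrite [X in (_ * X)%E]lebesgue_measure_period// -EFinM lee_fin; lra.
Qed.

Lemma sublevel2_eq0 : pm (EE `&` [set z | K z = 0%R]) = 0%E.
Proof.
have mS : measurable (EE `&` [set z | K z = 0] : set RR).
  apply: measurableI; first exact: measurable_square.
  rewrite -[X in measurable X]setTI.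
  by have := bK.1 measurableT [set 0] (measurable_set1 _).
apply/eqP; rewrite eq_le measure_ge0 andbT.
apply/lee_addgt0Pr => e e0; rewrite add0e.
(* [C] may be 0, hence the 1 added to the divisor of [e]. *)
have D0 : 0 < L * C + 1 by rewrite ltr_wpDl// mulr_ge0// ltW.
apply: (@le_trans _ _ (pm (EE `&` [set z | (K z < (e / (L * C + 1)) ^+ 2)%R]))).
  apply: le_measure; rewrite ?inE//; first exact: measurable_sublevel2.
  by move=> z [Ez /= ->]; split => //=; rewrite exprn_gt0// divr_gt0.
apply: le_trans; first by apply: measure_sublevel2; rewrite divr_gt0.
by rewrite lee_fin mulrCA ger_pMr// ler_pdivrMr// mul1r lerDl.
Qed.

(** With these radii the linear bound of [measure_sublevel2] becomes a geometric series in [n]. *)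
Let S (n : nat) : set RR := EE `&` [set z | K z < (2^-1 ^+ n) ^+ 2].

Let mS n : measurable (S n).
Proof. exact: measurable_sublevel2. Qed.

Let G (z : RR) : \bar R := (\sum_(n <oo) (\1_(S n) z)%:E)%E.

Let mindic n : measurable_fun EE (EFin \o (\1_(S n) : RR -> R)).
Proof. by apply/measurable_EFinP; apply: measurable_funTS; apply: measurable_indic; exact: mS. Qed.

Let G_ge0 z : (0 <= G z)%E.
Proof. by apply: nneseries_ge0 => n _ _; rewrite lee_fin. Qed.

Let integrable_G : pm.-integrable EE G.
Proof.
apply/integrableP; split.
  apply: (ge0_emeasurable_sum (P := xpredT)) => [k z _ _|k _]; last exact: mindic.
  by rewrite lee_fin.
under eq_integral => z _ do rewrite gee0_abs//.
rewrite integral_nneseries//; last exact: measurable_square.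
apply: (@le_lt_trans _ _ (L * C * 2)%:E%E); last exact: ltry.
(* [epsilon_trick0] has denominators 2^(n+1), starting at [n = 0], hence the factor 2. *)
apply: (@le_trans _ _ (\sum_(n <oo) (L * C * 2 / (2 ^ n.+1)%:R)%:E)%E); last first.
  by apply: epsilon_trick0; rewrite !mulr_ge0// ltW.
apply: lee_nneseries => [n _ _|n _]; first exact: integral_ge0.
rewrite integral_indic//; last exact: measurable_square.
rewrite setIidl; last by move=> z [].
apply: le_trans; first by apply: measure_sublevel2; rewrite exprn_gt0.
by rewrite lee_fin expnS natrM exprVn natrX invfM mulrA mulfK.
Qed.

(* |ln K| is at most a constant plus 2 ln 2 times the number G of n such that
   K < 2^(-2n).  Where K vanishes, ln K is the junk value 0. *)
Lemma integrable_ln_sublevel : pm.-integrable EE (EFin \o (fun z => ln (K z))).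
Proof.
have [mK [Q0 HQ]] := bK.
pose Q := Num.max 1 Q0.
have Q1 : 1 <= Q by rewrite le_max lexx.
have KQ z : EE z -> K z <= Q.
  by move=> Ez; rewrite le_max (le_trans (ler_norm _) (HQ z Ez)) orbT.
have l2 : 0 < ln (2 : R) by rewrite ln_gt0// ltr1n.
pose H z := ((ln Q)%:E + (2 * ln 2)%:E * G z)%E.
have H_ge0 z : (0 <= H z)%E.
  by rewrite adde_ge0 ?lee_fin ?ln_ge0// mule_ge0// lee_fin mulr_ge0// ltW.
have iH : pm.-integrable EE H.
  apply: integrableD; [exact: measurable_square| |].
    apply: (@bounded_integrable_square _ _ _ (fun=> ln Q) `|ln Q|) => //.
  by apply: integrableZl => //; exact: measurable_square.
apply: (le_integrable (measurable_square L)) iH.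
  apply/measurable_EFinP; apply: measurable_funTS.
  exact: measurableT_comp (@measurable_ln R) mK.
move=> z Ez; rewrite [leRHS]gee0_abs//= /H.
have [q1|q1] := leP 1 (K z).
  rewrite ger0_norm ?ln_ge0// -[leLHS]adde0 leeD//.
    by rewrite lee_fin ler_ln ?posrE ?KQ// (lt_le_trans ltr01)//.
  by rewrite mule_ge0// lee_fin mulr_ge0// ltW.
have [q0|q0] := eqVneq (K z) 0.
  by rewrite q0 ln0// normr0; exact: H_ge0.
have {}q0 : 0 < K z by rewrite lt_neqAle eq_sym q0 K_ge0.
have exn : exists n, (2^-1 ^+ n) ^+ 2 <= K z.
  have : (fun n => (4^-1 : R) ^+ n) @ \oo --> (0 : R).
    by apply: cvg_expr; rewrite ger0_norm// invf_lt1// ltr1n.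
  move=> /cvgrPdist_lt/(_ (K z) q0)[n _ /(_ n (leqnn n))] /=.
  rewrite sub0r normrN ger0_norm ?exprn_ge0// => /ltW h; exists n.
  by rewrite exprAC (_ : 2^-1 ^+ 2 = 4^-1 :> R)//; field.
(* For this least [n], the bound 4^(-n) <= K gives - ln K <= 2 n ln 2, while minimality puts [z] in
   [S i] for every [i < n], so that [G z] is at least [n]. *)
case: (ex_minnP exn) => n Hn nmin.
rewrite ler0_norm ?ln_le0 ?(ltW q1)//.
apply: (@le_trans _ _ ((2 * ln 2)%:E * n%:R%:E)%E).
  rewrite -EFinM lee_fin.
  have : ln ((2^-1 ^+ n) ^+ 2) <= ln (K z).
    by rewrite ler_ln ?posrE// !exprn_gt0.
  rewrite -exprM lnXn// lnV ?posrE// -[X in X <= _ -> _]mulr_natr natrM.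
  lra.
rewrite -[leLHS]add0e leeD ?lee_fin ?ln_ge0// lee_pmul2l//; last first.
  by rewrite lte_fin mulr_gt0.
apply: (@le_trans _ _ (\sum_(0 <= i < n) (\1_(S i) z)%:E)%E); last first.
  by apply: nneseries_lim_ge => i _ _; rewrite lee_fin.
rewrite sumEFin lee_fin big_mkord (eq_bigr (fun=> 1)).
  by rewrite sumr_const card_ord.
move=> i _; rewrite indicE mem_set// /S; split => //=.
by rewrite ltNge; apply/negP => /nmin; rewrite leqNgt ltn_ord.
Qed.

End log_integrable.

(** * Negativity of the logarithmic energy *)

Section log_energy.
Context {R : realType} (L : R).
Hypothesis L_gt0 : 0 < L.
Local Notation mu := (@lebesgue_measure R).
Local Notation E := (`[0, L[%classic : set R).
Local Notation EE := (E `*` E).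
Local Notation RR := (measurableTypeR R * measurableTypeR R)%type.
Local Notation pm := (@plane_measure R).
Context (g1 g2 dg1 dg2 : R -> R).
Hypothesis g1P : forall s, is_derive s (1 : R) g1 (dg1 s).
Hypothesis g2P : forall s, is_derive s (1 : R) g2 (dg2 s).
Hypothesis dg1c : continuous dg1.
Hypothesis dg2c : continuous dg2.
Hypothesis unit_speed : forall s, dg1 s ^+ 2 + dg2 s ^+ 2 = 1.
Hypothesis g_inj : forall s t, E s -> E t -> g1 s = g1 t -> g2 s = g2 t -> s = t.
Hypothesis g1_closed : g1 L = g1 0.
Hypothesis g2_closed : g2 L = g2 0.

Let g1c : continuous g1 := continuous_of_is_derive g1P.
Let g2c : continuous g2 := continuous_of_is_derive g2P.

Definition curve_sqdist (z : RR) : R := sqdist g1 g2 (g1 z.1, g2 z.1) z.2.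

Lemma curve_sqdist_ge0 z : 0 <= curve_sqdist z.
Proof. by rewrite addr_ge0// sqr_ge0. Qed.

Lemma bounded_curve_sqdist : bounded_kernel L curve_sqdist.
Proof.
have bN (f : R -> R) : continuous f -> bounded_kernel L (fun z => (f z.1 - f z.2) ^+ 2).
  move=> cf; apply: bounded_kernelX; apply: bounded_kernelD.
    exact: bounded_kernel_fst.
  apply: (@bounded_kernel_snd R L (fun t => - f t)) => t.
  by apply: cvgN; exact: cf.
by apply: bounded_kernelD; exact: bN.
Qed.

Lemma measure_curve_sublevel : exists2 C, 0 <= C & forall s (r : R), 0 < r ->
  (mu (E `&` [set t | curve_sqdist (s, t) < r ^+ 2]%R) <= (C * r)%:E)%E.
Proof.
have [C C0 HC] := measure_sublevel L_gt0 g1P g2P dg1c dg2c unit_speed.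
exists C => // s r r0; have := HC (g1 s, g2 s) r r0.
by rewrite /sublevel.
Qed.

Lemma integrable_ln_curve_sqdist :
  pm.-integrable EE (EFin \o (fun z => ln (curve_sqdist z))).
Proof.
have [C C0 HC] := measure_curve_sublevel.
exact: (integrable_ln_sublevel L_gt0 curve_sqdist_ge0 bounded_curve_sqdist C0 HC).
Qed.

(** The logarithmic series is only controlled where the squared distance is nonzero, so convergence
    and domination are claimed almost everywhere. *)
Lemma curve_sqdist_neq0_ae : {ae pm, forall z, EE z -> curve_sqdist z != 0}.
Proof.
have [C C0 HC] := measure_curve_sublevel.
have N0 := sublevel2_eq0 L_gt0 bounded_curve_sqdist C0 HC.
exists (EE `&` [set z | curve_sqdist z = 0]); split => //.
  apply: measurableI; first exact: measurable_square.
  rewrite -[X in measurable X]setTI.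
  by have := bounded_curve_sqdist.1 measurableT [set 0] (measurable_set1 _).
move=> z /= /not_implyP[Ez /negP]; rewrite negbK => /eqP z0.
by split.
Qed.

Let A s := 1 + g1 s ^+ 2 + g2 s ^+ 2.

Let A_ge1 s : 1 <= A s.
Proof. by rewrite /A -addrA lerDl addr_ge0// sqr_ge0. Qed.

Let A_gt0 s : 0 < A s.
Proof. exact: lt_le_trans (A_ge1 s). Qed.

Let Ac : continuous A.
Proof.
move=> s; apply: cvgD; last exact: (@continuous_exprn R _ 2 g2c).
apply: cvgD; first exact: cvg_cst.
exact: (@continuous_exprn R _ 2 g1c).
Qed.

(* The separable kernel of these four features is the stereographic kernel u
   above. *)
Definition stereo_phi (i : 'I_4) (s : R) : R :=
  nth 0 [:: 1; g1 s ^+ 2 + g2 s ^+ 2; Num.sqrt 2 * g1 s; Num.sqrt 2 * g2 s] i / A s.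

Lemma continuous_stereo_phi i : continuous (stereo_phi i).
Proof.
move=> s; rewrite /stereo_phi; apply: cvgM; last first.
  by apply: cvgV; [rewrite gt_eqF|exact: Ac].
case: i => -[|[|[|[|//]]]] ?.
- exact: cvg_cst.
- by apply: cvgD; [exact: (@continuous_exprn R _ 2 g1c)|exact: (@continuous_exprn R _ 2 g2c)].
- by apply: cvgM; [exact: cvg_cst|exact: g1c].
- by apply: cvgM; [exact: cvg_cst|exact: g2c].
Qed.

Let u := sep_kernel stereo_phi.

(** The features give the numerator 1 + |x|^2 |y|^2 + 2 x.y, which is (1 + |x|^2) (1 + |y|^2) - |x -
    y|^2. *)
Lemma stereo_kernelE s t : u s t = 1 - curve_sqdist (s, t) / (A s * A t).
Proof.
rewrite /u /sep_kernel !big_ord_recl big_ord0 /stereo_phi /= /curve_sqdist /sqdist /=.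
(* The root of 2 occurs only in pairs; once these are replaced, the identity is rational and within
   reach of [field]. *)
have s2 : Num.sqrt 2 * Num.sqrt 2 = 2 :> R by rewrite -expr2 sqr_sqrtr.
have {s2} mulE (x y a b : R) :
    Num.sqrt 2 * x / a * (Num.sqrt 2 * y / b) = 2 * (x / a * (y / b)).
  by move: (Num.sqrt 2 : R) s2 => r <-; ring.
rewrite !mulE {mulE}.
rewrite /A; field.
by rewrite !gt_eqF//; exact: A_gt0.
Qed.

Lemma stereo_kernel_ge0 s t : 0 <= u s t.
Proof.
rewrite stereo_kernelE subr_ge0 ler_pdivrMr ?mulr_gt0//.
rewrite mul1r /curve_sqdist /sqdist /= /A -subr_ge0.
rewrite (_ : _ - _ = (1 + (g1 s * g1 t + g2 s * g2 t)) ^+ 2 +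
  (g1 s * g2 t - g2 s * g1 t) ^+ 2); first by rewrite addr_ge0// sqr_ge0.
by ring.
Qed.

Lemma stereo_kernel_lt1 s t : curve_sqdist (s, t) != 0 -> u s t < 1.
Proof.
move=> st; rewrite stereo_kernelE ltrBlDr ltrDl divr_gt0 ?mulr_gt0//.
by rewrite lt_neqAle eq_sym st curve_sqdist_ge0.
Qed.

(** This is [- ln (1 - u)] off the diagonal, split so that the first two terms, each in one
    variable, integrate to 0 against [f z.1 * f z.2] when [f] has mean zero. *)
Let ell (z : RR) := ln (A z.1) + ln (A z.2) - ln (curve_sqdist z).

Let ellE z : curve_sqdist z != 0 -> ell z = - ln (1 - u z.1 z.2).
Proof.
move=> z0; rewrite /ell stereo_kernelE -surjective_pairing.
have Kz : 0 < curve_sqdist z by rewrite lt_neqAle eq_sym z0 curve_sqdist_ge0.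
rewrite opprB addrCA subrr addr0 ln_div ?posrE ?mulr_gt0// lnM ?posrE//.
by rewrite opprB.
Qed.

Let lnAc : continuous (fun s => ln (A s)).
Proof.
move=> s; apply: (@continuous_comp R R R A (@ln R)); first exact: Ac.
exact: continuous_ln.
Qed.

Lemma integrable_mul_ln (f h : R -> R) : continuous f -> continuous h ->
  pm.-integrable EE (EFin \o (fun z => f z.1 * h z.2 * ln (curve_sqdist z))).
Proof.
move=> cf ch.
have [mb [B HB]] : bounded_kernel L (fun z => f z.1 * h z.2).
  by apply: bounded_kernelM; [exact: bounded_kernel_fst|exact: bounded_kernel_snd].
apply: (@integrableMr _ _ _ pm EE (measurable_square L) (fun z => f z.1 * h z.2) _ _ _ integrable_ln_curve_sqdist).
  exact: measurable_funTS.
exists B; split; first exact: num_real.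
by move=> x Bx z /= Ez; exact: le_trans (HB z Ez) (ltW Bx).
Qed.

Section fixed_density.
Context (f : R -> R).
Hypothesis fc : continuous f.
Hypothesis f_mean0 : \int[mu]_(t in E) f t = 0.

Let bff : bounded_kernel L (fun z => f z.1 * f z.2).
Proof. by apply: bounded_kernelM; [exact: bounded_kernel_fst|exact: bounded_kernel_snd]. Qed.

Let integrable_ff_lnA1 : pm.-integrable EE (EFin \o (fun z => f z.1 * ln (A z.1) * f z.2)).
Proof.
apply: bounded_kernel_integrable => //; apply: bounded_kernelM; last exact: bounded_kernel_snd.
by apply: bounded_kernelM; [exact: bounded_kernel_fst|exact: (@bounded_kernel_fst R L (fun s => ln (A s)) lnAc)].
Qed.

Let integrable_ff_lnA2 : pm.-integrable EE (EFin \o (fun z => f z.1 * (f z.2 * ln (A z.2)))).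
Proof.
apply: bounded_kernel_integrable => //; apply: bounded_kernelM; first exact: bounded_kernel_fst.
by apply: bounded_kernelM; [exact: bounded_kernel_snd|exact: (@bounded_kernel_snd R L (fun s => ln (A s)) lnAc)].
Qed.

Let ffellE : (fun z => f z.1 * f z.2 * ell z) =
  (fun z => (f z.1 * ln (A z.1) * f z.2 + f z.1 * (f z.2 * ln (A z.2))) -
    f z.1 * f z.2 * ln (curve_sqdist z)).
Proof. by apply/funext => z; rewrite /ell; ring. Qed.

Let integrable_ffell : pm.-integrable EE (EFin \o (fun z => f z.1 * f z.2 * ell z)).
Proof.
rewrite ffellE; have mEE := measurable_square L.
exact: (integrableB mEE (integrableD mEE integrable_ff_lnA1 integrable_ff_lnA2)
  (integrable_mul_ln fc fc)).
Qed.

Let Rintegral_ffell : \int[pm]_(z in EE) (f z.1 * f z.2 * ell z) =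
  - \int[pm]_(z in EE) (f z.1 * f z.2 * ln (curve_sqdist z)).
Proof.
have mEE := measurable_square L.
rewrite ffellE (RintegralB mEE (integrableD mEE integrable_ff_lnA1 integrable_ff_lnA2)
  (integrable_mul_ln fc fc)) (RintegralD mEE integrable_ff_lnA1 integrable_ff_lnA2).
rewrite (@Rintegral_square_prod _ _ L_gt0 (fun s => f s * ln (A s)) f)//; last first.
  by move=> s; apply: cvgM; [exact: fc|exact: lnAc].
rewrite (@Rintegral_square_prod _ _ L_gt0 f (fun s => f s * ln (A s)))//; last first.
  by move=> s; apply: cvgM; [exact: fc|exact: lnAc].
by rewrite f_mean0 mulr0 mul0r addr0 sub0r.
Qed.

Let e n := energy L stereo_phi n f.

(** Dominated convergence: the terms of the series of [- ln (1 - u)] are nonnegative, so the partial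
    sums stay below their limit and |f f ell| dominates. *)
Lemma cvg_energy_series : (\sum_(n < m) e n.+1 / n.+1%:R) @[m --> \oo] -->
  - \int[pm]_(z in EE) (f z.1 * f z.2 * ln (curve_sqdist z)).
Proof.
pose F m z := f z.1 * f z.2 * \sum_(n < m) u z.1 z.2 ^+ n.+1 / n.+1%:R.
have bu : bounded_kernel L (fun z => u z.1 z.2).
  by apply: bounded_sep_kernel; exact: continuous_stereo_phi.
have bF m : bounded_kernel L (F m).
  apply: bounded_kernelM => //; apply: bounded_kernel_sum => n.
  by apply: bounded_kernelM; [exact: bounded_kernelX|exact: bounded_kernel_cst].
have IF m : \int[pm]_(z in EE) F m z = \sum_(n < m) e n.+1 / n.+1%:R.
  rewrite /F; under eq_Rintegral => z _.
    rewrite mulr_sumr; under eq_bigr => n _ do rewrite mulrA.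
    over.
  rewrite Rintegral_sum; [|exact: measurable_square|]; last first.
    move=> n; apply: bounded_kernel_integrable => //.
    apply: bounded_kernelM; last exact: bounded_kernel_cst.
    by apply: bounded_kernelM => //; exact: bounded_kernelX.
  apply: eq_bigr => n _; rewrite RintegralZr//; first exact: measurable_square.
  apply: bounded_kernel_integrable => //.
  by apply: bounded_kernelM => //; exact: bounded_kernelX.
under eq_fun do rewrite -IF.
rewrite -Rintegral_ffell.
have [|||||_ _ +] := @dominated_convergence _ _ _ pm EE (measurable_square L)
  (fun m => EFin \o F m) (EFin \o (fun z => f z.1 * f z.2 * ell z))
  (abse \o (EFin \o (fun z => f z.1 * f z.2 * ell z))).
- by move=> m; exact: measurable_int (bounded_kernel_integrable L_gt0 (bF m)).
- exact: measurable_int integrable_ffell.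
- apply: (@filterS _ _ (ae_filter_ringOfSetsType pm) _ _ _ curve_sqdist_neq0_ae) => z Hz Ez.
  have z0 := Hz Ez; apply: cvg_EFin; first by apply: nearW.
  apply: cvgM; first exact: cvg_cst.
  rewrite ellE//; apply: cvg_log_series.
  by rewrite stereo_kernel_ge0 stereo_kernel_lt1// -surjective_pairing.
- exact: integrable_abse.
- apply: (@filterS _ _ (ae_filter_ringOfSetsType pm) _ _ _ curve_sqdist_neq0_ae) => z Hz m Ez.
  have z0 := Hz Ez; rewrite /= lee_fin !normrM ler_wpM2l// ellE//.
  have u01 : 0 <= u z.1 z.2 < 1.
    by rewrite stereo_kernel_ge0 stereo_kernel_lt1// -surjective_pairing.
  rewrite ger0_norm; last first.
    by apply: sumr_ge0 => i _; rewrite divr_ge0// exprn_ge0// stereo_kernel_ge0.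
  exact: le_trans (log_partial_sum_le m u01) (ler_norm _).
have -> : (\int[pm]_(z in EE) (f z.1 * f z.2 * ell z)%:E)%E =
    (\int[pm]_(z in EE) (f z.1 * f z.2 * ell z))%:E.
  rewrite /Rintegral fineK//; apply: integrable_fin_num; last exact: integrable_ffell.
  exact: measurable_square.
exact: fine_cvg.
Qed.

Lemma log_energy_lt0 (s0 : R) : E s0 -> f s0 != 0 ->
  \int[pm]_(z in EE) (f z.1 * f z.2 * ln (curve_sqdist z)) < 0.
Proof.
move=> Es0 fs0; rewrite ltNge; apply/negP => I0.
have cphi := continuous_stereo_phi.
have e_ge0 n : 0 <= e n by exact: energy_ge0.
have nd : nondecreasing_seq (fun m => \sum_(n < m) e n.+1 / n.+1%:R).
  by apply/nondecreasing_seqP => m; rewrite big_ord_recr/= lerDl divr_ge0.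
(* The limit is [- \int], which is at most 0 by [I0], and it bounds the nondecreasing partial
   sums. *)
have S0 m : \sum_(n < m) e n.+1 / n.+1%:R <= 0.
  have := nondecreasing_cvgn_le nd (cvgP _ cvg_energy_series) m.
  rewrite (cvg_lim _ cvg_energy_series)// => /le_trans; apply.
  by rewrite oppr_le0.
have e0 n : e n = 0.
  (* The series starts at exponent 1; the energy of exponent 0 is the squared mean of [f]. *)
  case: n => [|n].
    rewrite /e /energy; under eq_Rintegral do rewrite expr0 mulr1.
    by rewrite Rintegral_square_prod// f_mean0 mulr0.
  have := S0 n.+1; rewrite big_ord_recr/= => h.
  have : e n.+1 / n.+1%:R <= 0.
    by apply: le_trans h; rewrite lerDr; apply: sumr_ge0 => i _; rewrite divr_ge0.
  rewrite pmulr_lle0 ?invr_gt0// => h'.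
  by apply/eqP; rewrite eq_le h' e_ge0.
(* The point may be the endpoint 0, whereas a peak has to be interior: continuity of [f] allows a
   small move to the right. *)
have [s /andP[s_gt0 s_ltL] fs] : exists2 s, 0 < s < L & f s != 0.
  have /= := Es0; rewrite in_itv/= => /andP[s00 s0L].
  have [||d d0 Hd] := @continuous_gt_near R (fun t => `|f t|) s0 0.
  - by apply: cvg_norm; exact: fc.
  - by rewrite normr_gt0.
  pose m := Num.min d (L - s0).
  have m0 : 0 < m by rewrite lt_min d0 subr_gt0.
  have md : m <= d by rewrite ge_min lexx.
  have mL : m <= L - s0 by rewrite ge_min lexx orbT.
  exists (s0 + m / 2); first by apply/andP; split; lra.
  rewrite -normr_gt0; apply: Hd; rewrite addrAC subrr add0r ger0_norm; lra.
have mom n : \int[mu]_(t in E) (f t * u s t ^+ n) = 0.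
  exact: (energy_eq0_moment L_gt0 cphi _ fc e0).
have uc : continuous (u s) by exact: continuous_sep_kernel.
have K0 t : curve_sqdist (t, t) = 0.
  by rewrite /curve_sqdist /sqdist /= !subrr expr0n addr0.
have us : u s s = 1 by rewrite stereo_kernelE K0 mul0r subr0.
have ult t : 0 <= t <= L -> t != s -> u s t < 1.
  move=> /andP[t0 tL] ts; apply: stereo_kernel_lt1.
  apply: contra_neq ts => /eqP.
  rewrite /curve_sqdist /sqdist /= paddr_eq0 ?sqr_ge0// !sqrf_eq0 !subr_eq0 => /andP[/eqP h1 /eqP h2].
  have Es : E s by rewrite /= in_itv/= s_ltL ltW.
  (* Injectivity covers the half-open period only. At [t = L] the curve is back at its origin, which
     would force [s = 0]. *)
  move: tL; rewrite le_eqVlt => /predU1P[tL|tL].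
    have s_eq0 : s = 0.
      apply: g_inj => //; first by rewrite /= in_itv/= lexx.
        by rewrite h1 tL.
      by rewrite h2 tL.
    by move: s_gt0; rewrite s_eq0 ltxx.
  by apply: g_inj => //; rewrite /= in_itv/= t0.
have u0 t : 0 <= t <= L -> 0 <= u s t by move=> _; exact: stereo_kernel_ge0.
have sL : 0 < s < L by rewrite s_gt0.
have [fs_lt|fs_gt|/eqP] := ltgtP (f s) 0; last by rewrite (negbTE fs).
  apply: (@peak_contra R L L_gt0 (fun t => - f t) (u s) s) => //.
  - by move=> t; apply: cvgN; exact: fc.
  - by rewrite oppr_gt0.
  move=> n; transitivity (\int[mu]_(t in E) (-1 * (f t * u s t ^+ n))).
    by apply: eq_Rintegral => t _; rewrite [RHS]mulN1r mulNr.
  rewrite RintegralZl ?mom ?mulr0//.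
  apply: continuous_integrable_itv => // t; apply: cvgM; first exact: fc.
  exact: (@continuous_exprn R _ n uc).
exact: (@peak_contra R L L_gt0 f (u s) s).
Qed.

End fixed_density.
End log_energy.

(** * Maximum principle for real parts of polynomials *)

Local Notation Re := complex.Re.
Local Notation Im := complex.Im.

Section local_max.
Context {R : realType}.
Local Notation C := (complex R).

Lemma poly_increase_near0 (H : {poly R}) (m : nat) (d : R) : 0 < d -> (0 < m)%N ->
  (forall k, (0 < k < m)%N -> H`_k = 0) -> 0 < H`_m ->
  exists2 rho, 0 < rho < d & H.[0] < H.[rho].
Proof.
move=> d0 m0 Hk Hm.
pose G := drop_poly m H.
have G0 : 0 < G.[0] by rewrite horner_coef0 coef_drop_poly.
have HE : H = (H`_0)%:P + G * 'X^m.
  rewrite -[LHS](poly_take_drop m); congr (_ + _).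
  apply/polyP => k; rewrite coef_take_poly coefC.
  case: k => [|k]; first by rewrite m0.
  by case: ifP => // km; rewrite Hk.
have [e e0 He] := @continuous_gt_near R (horner G) 0 0 (@continuous_horner _ G 0) G0.
pose rho := Num.min d e / 2.
have mde : 0 < Num.min d e by rewrite lt_min d0.
have md : Num.min d e <= d by rewrite ge_min lexx.
have me : Num.min d e <= e by rewrite ge_min lexx orbT.
exists rho; first by rewrite /rho; apply/andP; split; lra.
have HEx x : H.[x] = H`_0 + G.[x] * x ^+ m.
  by rewrite {1}HE hornerD hornerC hornerM hornerXn.
rewrite !HEx expr0n gtn_eqF// mulr0 addr0 ltrDl mulr_gt0//.
  by apply: He; rewrite subr0 ger0_norm /rho; lra.
by rewrite exprn_gt0// /rho; lra.
Qed.

Lemma Re_sum (I : Type) (r : seq I) (F : I -> C) :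
  Re (\sum_(i <- r) F i) = \sum_(i <- r) Re (F i).
Proof. by elim/big_rec2: _ => // i x [a b] _ <-; case: (F i). Qed.

Lemma Im_sum (I : Type) (r : seq I) (F : I -> C) :
  Im (\sum_(i <- r) F i) = \sum_(i <- r) Im (F i).
Proof. by elim/big_rec2: _ => // i x [a b] _ <-; case: (F i). Qed.

(** Around [z0], let [q_m] be the first nonzero Taylor coefficient of positive degree. Along a
    suitable ray the real part grows like a positive multiple of rho^m. *)
Lemma Re_poly_no_local_max (p : {poly C}) (z0 : C) (r : R) :
  (1 < size p)%N -> 0 < r ->
  exists w : C, [/\ `|Re w| < r, `|Im w| < r & Re p.[z0] < Re p.[z0 + w]].
Proof.
move=> sp r0; pose q := p \Po ('X + z0%:P).
have qE w : q.[w] = p.[z0 + w] by rewrite horner_comp !hornerE addrC.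
have sq : (1 < size q)%N by rewrite size_comp_poly2// size_XaddC.
have ex : exists m, (0 < m)%N && (q`_m != 0).
  exists (size q).-1; rewrite -lead_coefE lead_coef_eq0 -size_poly_eq0.
  by case: (size q) sq => [|[]].
case: (ex_minnP ex) => m /andP[m0 qm] mmin.
(* With this direction the coefficient of rho^m is [q_m] times its conjugate, a positive real. *)
have [e eE] : exists e : C, e ^+ m = (q`_m)^*%C.
  by exists (m.-root (q`_m)^*%C); rewrite rootCK.
pose H : {poly R} := \poly_(k < size q) Re (q`_k * e ^+ k).
have HE (rho : R) : H.[rho] = Re q.[(Complex rho 0) * e].
  rewrite horner_poly horner_coef Re_sum; apply: eq_bigr => k _.
  rewrite exprMn mulrCA.
  have -> : (Complex rho 0 : C) ^+ k = Complex (rho ^+ k) 0.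
    elim: (nat_of_ord k) => [|n IH]; first by rewrite !expr0.
    by rewrite !exprS IH; apply/eqP; rewrite eq_complex /= !mul0r !mulr0 subr0 addr0 !eqxx.
  by case: (q`_k * e ^+ k) => a b /=; rewrite mul0r subr0 mulrC.
(* [M] exceeds neither less than |Re e| nor |Im e| and is positive, so [rho < r / M] keeps [rho * e]
   in the required box. *)
pose M := `|Re e| + `|Im e| + 1.
have M0 : 0 < M by rewrite /M ltr_wpDl// addr_ge0.
have [|||rho /andP[rho0 rhor] Hrho] := @poly_increase_near0 H m (r / M) _ m0.
- by rewrite divr_gt0.
- move=> k /andP[k0 km]; rewrite coef_poly; case: ifP => // _.
  have : ~~ ((0 < k)%N && (q`_k != 0)) by apply: contraL km => /mmin; rewrite -leqNgt.
  by rewrite k0 /= negbK => /eqP ->; rewrite mul0r.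
- rewrite coef_poly; have -> : (m < size q)%N.
    by rewrite ltnNge; apply: contra qm => h; rewrite nth_default.
  rewrite eE; case: (q`_m) qm => a b /=.
  rewrite eq_complex /= negb_and => ab; rewrite mulrN opprK -!expr2.
  by case/orP: ab => ?; [rewrite ltr_pwDl|rewrite ltr_wpDl]; rewrite ?sqr_ge0// exprn_even_gt0.
exists (Complex rho 0 * e); rewrite -!qE -HE.
have -> : Re p.[z0] = H.[0].
  by rewrite HE -[Complex 0 0]/(0 : C) mul0r qE addr0.
rewrite ltr_pdivlMr// in rhor; split => //.
- rewrite (_ : Re _ = rho * Re e); last by case: (e) => a b /=; rewrite mul0r subr0.
  rewrite normrM (ger0_norm (ltW rho0)); apply: le_lt_trans rhor.
  by rewrite ler_pM2l// /M -addrA lerDl addr_ge0.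
- rewrite (_ : Im _ = rho * Im e); last by case: (e) => a b /=; rewrite mul0r addr0.
  rewrite normrM (ger0_norm (ltW rho0)); apply: le_lt_trans rhor.
  by rewrite ler_pM2l// /M addrAC addrC lerDl addr_ge0.
Qed.

Definition toC (x : R * R) : C := Complex x.1 x.2.

Lemma continuous_Re_Im_poly (p : {poly C}) :
  continuous (fun x => Re p.[toC x]) /\ continuous (fun x => Im p.[toC x]).
Proof.
elim/poly_ind: p => [|p c [IHr IHi]].
  by split => x; under eq_fun do rewrite horner0 /=; exact: cvg_cst.
have ReE x : Re (p * 'X + c%:P).[toC x] =
    (Re p.[toC x] * x.1 - Im p.[toC x] * x.2) + Re c.
  by rewrite !hornerE; case: (p.[_]) => a b; case: (c).
have ImE x : Im (p * 'X + c%:P).[toC x] =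
    (Re p.[toC x] * x.2 + Im p.[toC x] * x.1) + Im c.
  by rewrite !hornerE; case: (p.[_]) => a b; case: (c).
split => x.
  under eq_fun do rewrite ReE; apply: cvgD; last exact: cvg_cst.
  by apply: cvgB; apply: cvgM; [exact: IHr|exact: cvg_fst|exact: IHi|exact: cvg_snd].
under eq_fun do rewrite ImE; apply: cvgD; last exact: cvg_cst.
by apply: cvgD; apply: cvgM; [exact: IHr|exact: cvg_snd|exact: IHi|exact: cvg_fst].
Qed.

Lemma closure_bounded_compact (D : set (R * R)) : bounded_set D -> compact (closure D).
Proof.
move=> [M [_ HM]]; pose N := `|M| + 1.
have NM : M < N by rewrite (le_lt_trans (ler_norm _))// ltrDl.
pose B : set (R * R) := `[- N, N]%classic `*` `[- N, N]%classic.
have cB : compact B by apply: compact_setX; exact: segment_compact.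
have DB : closure D `<=` B.
  have -> : B = closure B.
    by apply/closure_id; apply: compact_closed => //; exact: norm_hausdorff.
  apply: closure_subset => x Dx.
  have := HM N NM x Dx; rewrite /= prod_normE ge_max => /andP[h1 h2].
  by split; rewrite /= in_itv/= -ler_norml.
by apply: subclosed_compact cB DB; exact: closed_closure.
Qed.

Lemma Re_poly_open_increase (D : set (R * R)) (p : {poly C}) x :
  open D -> (1 < size p)%N -> D x ->
  exists2 y, D y & Re p.[toC x] < Re p.[toC y].
Proof.
move=> oD sp Dx; have /nbhs_ballP[d /= d0 Hd] : nbhs x D by exact: open_nbhs_nbhs.
have [w [w1 w2 pw]] := Re_poly_no_local_max (toC x) sp d0.
exists (x.1 + Re w, x.2 + Im w); last by move: pw; case: (w).
by apply: Hd; split => /=; rewrite /ball/= opprD addrA subrr add0r normrN.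
Qed.

Lemma Re_poly_le_of_frontier (D : set (R * R)) (p : {poly C}) (c : R) :
  D !=set0 -> open D -> bounded_set D -> (1 < size p)%N ->
  (forall x, frontier D x -> Re p.[toC x] = c) ->
  forall x, D x -> Re p.[toC x] <= c.
Proof.
move=> [x0 Dx0] oD bD sp fc x Dx.
have cf : continuous (fun x => Re p.[toC x]) := (continuous_Re_Im_poly p).1.
have K0 : closure D !=set0 by exists x0; exact: subset_closure.
have [y /[!inE] yK ymax] :=
  compact_EVT_max K0 (closure_bounded_compact bD) (continuous_subspaceT cf).
rewrite -(fc y); first by apply: ymax; rewrite inE; exact: subset_closure.
split => // /interior_subset Dy.
have [z Dz] := Re_poly_open_increase oD sp Dy.
by rewrite ltNge ymax// inE; exact: subset_closure.
Qed.

(** The maximum principle for [p] and for [- p] would make the real part constant on [D], although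
    it can be increased from any point of the open set. *)
Lemma frontier_not_level_set (D : set (R * R)) (p : {poly C}) (c : R) :
  D !=set0 -> open D -> bounded_set D -> (1 < size p)%N ->
  ~ (forall x, frontier D x -> Re p.[toC x] = c).
Proof.
move=> D0 oD bD sp fc.
have Re_opp x : Re (- p).[toC x] = - Re p.[toC x].
  by rewrite hornerN; case: (p.[_]).
have ub := Re_poly_le_of_frontier D0 oD bD sp fc.
have lb x : D x -> c <= Re p.[toC x].
  move=> Dx; rewrite -lerN2 -Re_opp.
  apply: (Re_poly_le_of_frontier (D := D)) => //; first by rewrite size_polyN.
  by move=> z /fc <-.
have [x Dx] := D0; have [y Dy] := Re_poly_open_increase oD sp Dx.
by rewrite ltNge (le_trans (ub y Dy) (lb x Dx)).
Qed.

End local_max.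

(** * Determinants and definite forms *)

Section posdef_det.
Context {R : rcfType}.

Definition qform n (A : 'M[R]_n) (v : 'cV[R]_n) : R := (v^T *m A *m v) 0 0.

Lemma qformD n (A B : 'M[R]_n) v : qform (A + B) v = qform A v + qform B v.
Proof. by rewrite /qform mulmxDr mulmxDl mxE. Qed.

Lemma qformZ n (A : 'M[R]_n) a v : qform (a *: A) v = a * qform A v.
Proof. by rewrite /qform -scalemxAr -scalemxAl mxE. Qed.

Lemma qform1_gt0 n (v : 'cV[R]_n) : v != 0 -> 0 < qform 1%:M v.
Proof.
move=> v0; rewrite /qform mulmx1 mxE.
have sq i : 0 <= v^T 0 i * v i 0 by rewrite mxE -expr2 sqr_ge0.
rewrite lt_neqAle eq_sym sumr_ge0// andbT psumr_eq0//.
apply: contra v0 => /allP h; apply/eqP/matrixP => i j; rewrite !mxE ord1.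
have := h i; rewrite mem_index_enum => /(_ isT) /=.
by rewrite mxE -expr2 sqrf_eq0 => /eqP.
Qed.

(* The determinant does not vanish along the segment from the identity to A. *)
Lemma det_gt0_of_qform_gt0 n (A : 'M[R]_n) :
  (forall v, v != 0 -> 0 < qform A v) -> 0 < \det A.
Proof.
move=> Apos.
pose B (t : R) := t *: A + (1 - t) *: 1%:M.
(* The determinant along the segment is written as a polynomial in its parameter, so that the
   intermediate value theorem for polynomials yields a root. *)
pose P : {poly R} := \det (\matrix_(i, j) ((A i j)%:P * 'X + (1 - 'X) * ((i == j)%:R)%:P)).
have PE t : P.[t] = \det (B t).
  rewrite -horner_evalE -det_map_mx; congr (\det _).
  apply/matrixP => i j; rewrite !mxE /= horner_evalE !hornerE.
  by rewrite mulrC.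
have B_neq0 t : 0 <= t <= 1 -> \det (B t) != 0.
  move=> /andP[t0 t1]; apply/negP => /det0P[w w0 wB].
  have v0 : w^T != 0 by rewrite -(inj_eq trmx_inj) trmxK trmx0.
  have : qform (B t) w^T = 0 by rewrite /qform trmxK wB mul0mx mxE.
  rewrite qformD !qformZ; have h1 := Apos _ v0; have h2 := qform1_gt0 v0.
  by move=> ?; nra.
have B0 : \det (B 0) = 1 by rewrite /B scale0r add0r subr0 scale1r det1.
have B1 : \det (B 1) = \det A by rewrite /B subrr scale0r addr0 scale1r.
rewrite -B1 ltNge; apply/negP => B1le.
have [||t t01 /rootP] := @poly_ivt R (- P) 0 1.
- by rewrite ler01.
- by rewrite !hornerN !PE B0 oppr_le0 ler01 oppr_ge0.
rewrite hornerN PE => /eqP; rewrite oppr_eq0.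
by rewrite (negbTE (B_neq0 t _)).
Qed.

Lemma det_gt0_of_qform_lt0 n (A : 'M[R]_n) : ~~ odd n ->
  (forall v, v != 0 -> qform A v < 0) -> 0 < \det A.
Proof.
move=> n_even Aneg.
have -> : \det A = \det (- A).
  by rewrite -scaleN1r detZ -signr_odd (negbTE n_even) expr0 mul1r.
apply: det_gt0_of_qform_gt0 => v v0.
by rewrite -scaleN1r qformZ mulN1r oppr_gt0 Aneg.
Qed.

Lemma block_det_gt0 m n (P : 'M[R]_m) (Q : 'M[R]_n) (N : 'M[R]_(m, n)) (k : R) :
  ~~ odd (m + n) -> 0 < k ->
  (forall v, v != 0 -> qform P v < 0) -> (forall v, v != 0 -> qform Q v < 0) ->
  0 < \det (block_mx ((k + 1) *: P) ((2 * k) *: N) (- 2 *: N^T) ((k + 1) *: Q)).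
Proof.
move=> even k0 Pneg Qneg; set M := block_mx _ _ _ _.
pose S : 'M[R]_(m + n) := block_mx 1%:M 0 0 k%:M.
have detS : \det S = k ^+ n by rewrite /S det_ublock det1 mul1r det_scalar.
suff : 0 < \det (S *m M).
  by rewrite det_mulmx detS pmulr_rgt0// exprn_gt0.
apply: det_gt0_of_qform_lt0 => // v v0.
rewrite -[v]vsubmxK; set p := usubmx v; set q := dsubmx v.
have -> : qform (S *m M) (col_mx p q) = (k + 1) * qform P p + k * (k + 1) * qform Q q.
  rewrite /qform /S /M mulmx_block !mul1mx !mul0mx !addr0 !add0r !mul_scalar_mx.
  rewrite tr_col_mx mul_row_block mul_row_col !mulmxDl.
  have -> : (q^T *m (k *: (- 2 *: N^T)) *m p) = (k * - 2) *: (p^T *m N *m q)^T.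
    by rewrite scalerA -scalemxAr -scalemxAl !trmx_mul trmxK mulmxA.
  rewrite -!scalemxAr -!scalemxAl.
  move: (p^T *m P *m p) (p^T *m N *m q) (q^T *m Q *m q) => X Y Z.
  by rewrite !mxE; ring.
have P0 w : w = 0 \/ qform P w < 0 by have [->|/Pneg] := eqVneq w 0; [left|right].
have Q0 w : w = 0 \/ qform Q w < 0 by have [->|/Qneg] := eqVneq w 0; [left|right].
have qf0 r (A : 'M[R]_r) : qform A 0 = 0 by rewrite /qform mulmx0 mxE.
have [p0|pneg] := P0 p; have [q0|qneg] := Q0 q.
- by move: v0; rewrite -[v]vsubmxK -/p -/q p0 q0 col_mx0 eqxx.
- rewrite p0 qf0 mulr0 add0r; nra.
- rewrite q0 qf0 mulr0 addr0; nra.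
- nra.
Qed.

End posdef_det.

(** * Derivatives of real and imaginary parts of polynomials *)

Section derivatives.
Context {R : realType}.
Local Notation C := (complex R).

Lemma is_derive_fst (V : normedModType R) (c : V -> R * R) (x v : V) (d : R * R) :
  is_derive x v c d -> is_derive x v (fun y => (c y).1) d.1.
Proof.
move=> [cd dE].
have {}dE : (fun h : R => h^-1 *: (c (h *: v + x) - c x)) @ 0^' --> d.
  by rewrite -dE; exact: cd.
have h : (fun h : R => h^-1 *: ((c (h *: v + x)).1 - (c x).1)) @ 0^' --> d.1.
  have cf : {for d, continuous (fst : R * R -> R)} by exact: cvg_fst.
  have := continuous_cvg _ cf dE.
  exact.
by apply: DeriveDef; [exact: cvgP h|exact: cvg_lim h].
Qed.

Lemma is_derive_snd (V : normedModType R) (c : V -> R * R) (x v : V) (d : R * R) :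
  is_derive x v c d -> is_derive x v (fun y => (c y).2) d.2.
Proof.
move=> [cd dE].
have {}dE : (fun h : R => h^-1 *: (c (h *: v + x) - c x)) @ 0^' --> d.
  by rewrite -dE; exact: cd.
have h : (fun h : R => h^-1 *: ((c (h *: v + x)).2 - (c x).2)) @ 0^' --> d.2.
  have cf : {for d, continuous (snd : R * R -> R)} by exact: cvg_snd.
  exact: (continuous_cvg _ cf dE).
by apply: DeriveDef; [exact: cvgP h|exact: cvg_lim h].
Qed.

(** One chain rule for two uses: [c] is the boundary curve for tangential derivatives, and the
    identity of the plane for the gradient. Multiplication by z mixes the two parts, hence the joint
    induction. *)
Lemma is_derive_Re_Im_poly (V : normedModType R) (c : V -> R * R) (x v : V)
    (d1 d2 : R) (p : {poly C}) :
  is_derive x v (fun y => (c y).1) d1 -> is_derive x v (fun y => (c y).2) d2 ->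
  is_derive x v (fun y => Re p.[toC (c y)]) (Re (p^`().[toC (c x)] * Complex d1 d2)) /\
  is_derive x v (fun y => Im p.[toC (c y)]) (Im (p^`().[toC (c x)] * Complex d1 d2)).
Proof.
move=> D1 D2; elim/poly_ind: p => [|p k [IHr IHi]].
  rewrite deriv0 horner0 mul0r /=.
  by split; under eq_fun do rewrite horner0 /=; exact: is_derive_cst.
have ReE y : Re (p * 'X + k%:P).[toC y] =
    (Re p.[toC y] * y.1 - Im p.[toC y] * y.2) + Re k.
  by rewrite !hornerE; case: (p.[_]) => a b; case: (k).
have ImE y : Im (p * 'X + k%:P).[toC y] =
    (Re p.[toC y] * y.2 + Im p.[toC y] * y.1) + Im k.
  by rewrite !hornerE; case: (p.[_]) => a b; case: (k).
rewrite derivD derivC addr0 derivM derivX mulr1 !hornerE.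
split.
  under eq_fun do rewrite ReE.
  have := is_deriveD (is_deriveB (is_deriveM IHr D1) (is_deriveM IHi D2)) (is_derive_cst (Re k) x v).
  move=> /is_derive_eq; apply; rewrite /GRing.scale /=.
  by rewrite /toC; move: (p^`().[_]) (p.[_]) => [a b] [a' b'] /=; ring.
under eq_fun do rewrite ImE.
have := is_deriveD (is_deriveD (is_deriveM IHr D2) (is_deriveM IHi D1)) (is_derive_cst (Im k) x v).
move=> /is_derive_eq; apply; rewrite /GRing.scale /=.
by rewrite /toC; move: (p^`().[_]) (p.[_]) => [a b] [a' b'] /=; ring.
Qed.

(** Im z^n is the real part of -i z^n, so every basis function is the real part of a polynomial.
    Here [i] starts at 0, which reverses the parity used by [Ppoly]. *)
Definition poly_of_index (i : nat) : {poly C} :=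
  (if odd i then Complex 0 (-1) else 1) *: 'X^(i./2.+1).

Lemma PpolyE i x : Ppoly i.+1 x = Re (poly_of_index i).[toC x] :> R.
Proof.
rewrite /Ppoly /poly_of_index hornerZ hornerXn /=.
case: ifP => /= oi; rewrite ?oi /=.
  by rewrite (negbTE oi) mul1r.
rewrite (negbFE oi) (_ : uphalf i = i./2.+1); last by rewrite uphalf_half (negbFE oi).
rewrite /b_ /cpow /toC; case: (_ ^+ _) => a b /=; by rewrite mul0r sub0r mulN1r opprK.
Qed.

(** Cauchy-Riemann: read as a complex number, the gradient of Re p is the conjugate of p'. *)
Lemma grad_Re_poly (p : {poly C}) (x : R * R) :
  grad (fun y => Re p.[toC y]) x = (Re p^`().[toC x], - Im p^`().[toC x]).
Proof.
rewrite /grad.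
have H v : is_derive x v (fun y => Re p.[toC y]) (Re (p^`().[toC x] * Complex v.1 v.2)).
  apply: (is_derive_Re_Im_poly (c := id) _ _ _).1.
    exact: is_derive_fst (is_derive_id x v).
  exact: is_derive_snd (is_derive_id x v).
have [_ ->] := H (1, 0); have [_ ->] := H (0, 1).
by case: (p^`().[_]) => a b /=; congr (_, _); ring.
Qed.

End derivatives.

(** * Geometry of the boundary curve *)

Section boundary_curve.
Context {R : realType} (D : set (R * R)) (L : R) (gamma : R -> R * R).
Hypothesis gammaP : arclength_param D L gamma.

Let g1 s := (gamma s).1.
Let g2 s := (gamma s).2.
Let dg1 s := (derive1 gamma s).1.
Let dg2 s := (derive1 gamma s).2.

Lemma period_gt0 : 0 < L. Proof. by case: gammaP. Qed.

Lemma is_derive_gamma s : is_derive s (1 : R) gamma (derive1 gamma s).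
Proof.
case: gammaP => _ [dg _] _ _ _.
by apply: DeriveDef; [exact: dg|rewrite derive1E].
Qed.

Lemma is_derive_gamma1 s : is_derive s (1 : R) g1 (dg1 s).
Proof. exact: is_derive_fst (is_derive_gamma s). Qed.

Lemma is_derive_gamma2 s : is_derive s (1 : R) g2 (dg2 s).
Proof. exact: is_derive_snd (is_derive_gamma s). Qed.

Lemma continuous_dgamma1 : continuous dg1.
Proof.
case: gammaP => _ [_ dgc] _ _ _ s.
by apply: (@continuous_comp _ _ _ (derive1 gamma) fst); [exact: dgc|exact: cvg_fst].
Qed.

Lemma continuous_dgamma2 : continuous dg2.
Proof.
case: gammaP => _ [_ dgc] _ _ _ s.
by apply: (@continuous_comp _ _ _ (derive1 gamma) snd); [exact: dgc|exact: cvg_snd].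
Qed.

Lemma enorm_eq1 (v : R * R) : enorm v = 1 -> v.1 ^+ 2 + v.2 ^+ 2 = 1.
Proof.
move=> v1; rewrite -[RHS](expr1n _ 2) -v1 sqr_sqrtr /dot -?expr2//.
by rewrite addr_ge0// sqr_ge0.
Qed.

Lemma unit_speed_gamma s : dg1 s ^+ 2 + dg2 s ^+ 2 = 1.
Proof. by case: gammaP => _ _ us _ _; exact: enorm_eq1 (us s). Qed.

Lemma gamma_closed : gamma L = gamma 0.
Proof. by case: gammaP => _ _ _ per _; rewrite -[L in LHS]add0r per. Qed.

Lemma gamma_injective s t : `[0, L[%classic s -> `[0, L[%classic t ->
  g1 s = g1 t -> g2 s = g2 t -> s = t.
Proof.
case: gammaP => _ _ _ _ [inj _] Es Et h1 h2; apply: inj; rewrite ?inE//.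
by move: h1 h2; rewrite /g1 /g2; case: (gamma s) (gamma t) => [? ?] [? ?] /= -> ->.
Qed.

Lemma gamma_frontier s : frontier D (gamma s).
Proof.
case: gammaP => L0 _ _ per [_ im].
have perN (n : nat) t : gamma (t + n%:R * L) = gamma t.
  elim: n => [|n IH]; first by rewrite mul0r addr0.
  by rewrite -natr1 mulrDl mul1r addrA per.
have perZ (m : int) t : gamma (t + m%:~R * L) = gamma t.
  case: m => n; first by rewrite -pmulrn perN.
  by rewrite -(perN n.+1 (_ + _)) NegzE mulrNz -pmulrn mulNr subrK.
pose m := Num.floor (s / L); pose r := s - m%:~R * L.
have -> : gamma s = gamma r by rewrite -(perZ m r) /r subrK.
rewrite -im; exists r => //=; rewrite in_itv/= /r subr_ge0 ltrBlDr.
rewrite -ler_pdivlMr// floor_le/= -[X in _ < X + _]mul1r -mulrDl -ltr_pdivrMr//.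
by rewrite addrC -intrD1 floorD1_gt.
Qed.

Lemma enorm_sqr (v : R * R) : enorm v ^+ 2 = v.1 ^+ 2 + v.2 ^+ 2.
Proof. by rewrite sqr_sqrtr /dot -?expr2// addr_ge0// sqr_ge0. Qed.

Lemma enorm_ge0 (v : R * R) : 0 <= enorm v.
Proof. exact: sqrtr_ge0. Qed.

(** The mean value theorem is applied to the component along the chord [w] itself, whose increment
    is -|w|^2; Cauchy-Schwarz bounds its derivative by |w|. *)
Lemma gamma_lipschitz s t : s <= t -> enorm (gamma s - gamma t) <= t - s.
Proof.
move=> st; set w := gamma s - gamma t.
pose h u := w.1 * g1 u + w.2 * g2 u; pose dh u := w.1 * dg1 u + w.2 * dg2 u.
have hP u : is_derive u (1 : R) h (dh u).
  exact: is_deriveD (is_deriveZ w.1 (is_derive_gamma1 u)) (is_deriveZ w.2 (is_derive_gamma2 u)).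
have [|u _ hst] := @MVT_segment R h dh s t st (fun x _ => hP x).
  exact/continuous_subspaceT/(continuous_of_is_derive hP).
have w1 : w.1 = g1 s - g1 t by [].
have w2 : w.2 = g2 s - g2 t by [].
have {}hst : enorm w ^+ 2 = - dh u * (t - s).
  by rewrite mulNr -hst enorm_sqr /h [in LHS]w1 [in LHS]w2 w1 w2; ring.
have dhw : dh u ^+ 2 <= enorm w ^+ 2.
  rewrite enorm_sqr -[leRHS]mul1r -(unit_speed_gamma u) -subr_ge0 /dh.
  rewrite [leRHS](_ : _ = (dg1 u * w.2 - dg2 u * w.1) ^+ 2); last by ring.
  exact: sqr_ge0.
have w0 := enorm_ge0 w.
have dhw' : - dh u <= enorm w by rewrite leNgt; apply/negP => ?; nra.
have [->|wn0] := eqVneq (enorm w) 0; first by rewrite subr_ge0.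
have {}w0 : 0 < enorm w by rewrite lt_neqAle eq_sym wn0.
rewrite -(ler_pM2l w0) -expr2 hst ler_wpM2r// subr_ge0//.
Qed.

(** The chord is at most as long as each of the two complementary arcs, whose lengths add up to
    [L]. *)
Lemma diameter_lt (kappa : R) : L < 2 * kappa ->
  forall x y, frontier D x -> frontier D y -> enorm (x - y) < kappa.
Proof.
move=> Lk; case: (gammaP) => L0 _ _ per [_ im] x y.
rewrite -im => -[s /= /[!in_itv]/= /andP[s0 sL] <-] [t /= /[!in_itv]/= /andP[t0 tL] <-].
have symm (a b : R * R) : enorm (a - b) = enorm (b - a).
  by rewrite /enorm /dot /=; congr Num.sqrt; ring.
wlog st : s t s0 sL t0 tL / s <= t.
  by move=> H; have [/H|/ltW/H] := leP s t; [exact|rewrite symm; exact].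
have h1 := gamma_lipschitz st.
have h2 : enorm (gamma t - gamma (s + L)) <= s + L - t by apply: gamma_lipschitz; lra.
by rewrite per symm in h2; lra.
Qed.

End boundary_curve.

(** * Constancy of the side on which the outward normal lies *)

Section orientation.
Context {R : realType} (D : set (R * R)) (L : R) (gamma : R -> R * R).
Context (nu : R * R -> R * R).
Hypothesis oD : open D.
Hypothesis C1D : C1_boundary D.
Hypothesis gammaP : arclength_param D L gamma.
Hypothesis nuP : outward_unit_normal D gamma nu.

Definition rot90 (v : R * R) : R * R := (- v.2, v.1).

(** Equal to 1 if the outward normal is to the left of the direction of travel, and to -1 if it is
    to the right. *)
Definition orient (s : R) : R := dot (nu (gamma s)) (rot90 (derive1 gamma s)).

Lemma normal_rot s : nu (gamma s) = orient s *: rot90 (derive1 gamma s) :> R * R.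
Proof.
have [n1 nt _] := nuP s; have us := unit_speed_gamma gammaP s.
move: us nt; rewrite /orient /dot /rot90 /=.
case: (nu _) (derive1 gamma s) => [a b] [c d] /= us nt.
congr (_, _); apply: subr0_eq; rewrite /GRing.scale /=.
  transitivity (a * (1 - (c ^+ 2 + d ^+ 2)) + c * (a * c + b * d)); first by ring.
  by rewrite us nt subrr !mulr0 addr0.
transitivity (b * (1 - (c ^+ 2 + d ^+ 2)) + d * (a * c + b * d)); first by ring.
by rewrite us nt subrr !mulr0 addr0.
Qed.

Lemma orient_sqr s : orient s ^+ 2 = 1.
Proof.
have [/enorm_eq1 + _ _] := nuP s; rewrite normal_rot /= => <-.
by rewrite /GRing.scale /= -[LHS]mulr1 -(unit_speed_gamma gammaP s); ring.
Qed.

Lemma orient_pm1 s : orient s = 1 \/ orient s = -1.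
Proof.
move: (orient s) (orient_sqr s) => x /eqP; rewrite sqrf_eq1.
by case/orP => /eqP ->; [left|right].
Qed.

Lemma continuous_dotl (e : R * R) : continuous (fun x : R * R => dot x e).
Proof.
move=> x; rewrite /dot; apply: cvgD; apply: cvgM; try exact: cvg_cst.
  exact: cvg_fst.
exact: cvg_snd.
Qed.

Lemma continuous_enormB (x0 : R * R) : continuous (fun x : R * R => enorm (x - x0)).
Proof.
move=> x; apply: (@continuous_comp _ _ _ (fun x : R * R => dot (x - x0) (x - x0)) Num.sqrt); last exact: sqrt_continuous.
rewrite /dot /=; apply: cvgD; apply: cvgM; apply: cvgB; try exact: cvg_cst;
  (exact: cvg_fst || exact: cvg_snd).
Qed.

Section chart.
Context (x0 : R * R) (r : R) (e : R * R) (phi : R -> R).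
Hypothesis e_unit : enorm e = 1.
Hypothesis phi_C1 : C1 phi.
Hypothesis chart : forall x, enorm (x - x0) < r ->
  (D x <-> phi (dot x (e.2, - e.1)) < dot x e).

Let U s := dot (gamma s) (e.2, - e.1).
Let V s := dot (gamma s) e.
Let dU s := dot (derive1 gamma s) (e.2, - e.1).
Let dV s := dot (derive1 gamma s) e.

Let phic : continuous phi.
Proof.
move=> y; apply: differentiable_continuous; apply/derivable1_diffP.
by case: phi_C1.
Qed.

Let is_derive_dot (a : R * R) s :
  is_derive s (1 : R) (fun s => dot (gamma s) a) (dot (derive1 gamma s) a).
Proof.
have d1 := is_derive_gamma1 gammaP s; have d2 := is_derive_gamma2 gammaP s.
have := is_deriveD (is_deriveM d1 (is_derive_cst a.1 s 1)) (is_deriveM d2 (is_derive_cst a.2 s 1)).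
by move=> /is_derive_eq; apply; rewrite /GRing.scale /= /dot; ring.
Qed.

(** Strictly above the graph the point would be in the open set [D]; strictly below, a whole
    neighbourhood would miss [D]. *)
Lemma frontier_graph y : enorm (y - x0) < r -> frontier D y ->
  dot y e = phi (dot y (e.2, - e.1)).
Proof.
move=> yr [cly niy].
have nDy : ~ D y by move=> Dy; apply: niy; rewrite (interior_id _).1.
apply/eqP; rewrite eq_le leNgt; apply/andP; split.
  by apply/negP => h; apply: nDy; apply/chart.
rewrite leNgt; apply/negP => h.
have n1 : \forall z \near y, enorm (z - x0) < r.
  by apply: (cvgr_lt _ (@continuous_enormB x0 y)).
have n2 : \forall z \near y, dot z e - phi (dot z (e.2, - e.1)) < 0.
  have c2 : {for y, continuous (fun z => dot z e - phi (dot z (e.2, - e.1)))}.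
    apply: cvgB; first exact: continuous_dotl.
    apply: (@continuous_comp _ _ _ (fun z => dot z (e.2, - e.1)) phi); last exact: phic.
    exact: continuous_dotl.
  by apply: (cvgr_lt _ c2); rewrite subr_lt0.
have [z [Dz [z1 z2]]] := cly _ (filterI n1 n2).
by move: z2; rewrite subr_lt0 ltNge => /negP; apply; apply: ltW; apply/chart.
Qed.

Let dVE s : enorm (gamma s - x0) < r -> dV s = derive1 phi (U s) * dU s.
Proof.
move=> sr.
have gc : continuous gamma.
  move=> t; apply: differentiable_continuous; apply/derivable1_diffP.
  by case: gammaP => _ [].
have near_s : \forall t \near s, V t = (phi \o U) t.
  have : \forall t \near s, enorm (gamma t - x0) < r.
    have c : {for s, continuous ((fun x => enorm (x - x0)) \o gamma)}.
      by apply: continuous_comp; [exact: gc|exact: continuous_enormB].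
    exact: (cvgr_lt _ c).
  apply: filterS => t tr; apply: frontier_graph => //.
  exact: gamma_frontier gammaP t.
have dphi : is_derive (U s) (1 : R) phi (derive1 phi (U s)).
  by case: phi_C1 => h _; apply: DeriveDef; [exact: h|rewrite derive1E].
have [_ E1] := is_derive_dot e s.
have [_ E2] := is_derive1_comp dphi (is_derive_dot (e.2, - e.1) s).
rewrite -[LHS]E1 -[RHS]E2; exact: near_eq_derive.
Qed.

(* D lies above the graph of phi, so an outward normal points below it, whereas
   orient compares the normal with the direction of travel along the graph. *)
Lemma orient_dU s : enorm (gamma s - x0) < r -> dU s != 0 /\ orient s * dU s <= 0.
Proof.
move=> sr; have dVs := dVE sr.
have us := unit_speed_gamma gammaP s; have eu := enorm_eq1 e_unit.
have UV : dU s ^+ 2 + dV s ^+ 2 = 1.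
  by rewrite -[RHS]mulr1 -{1}us -eu /dU /dV /dot /=; ring.
split.
  by apply/eqP => dU0; move: UV; rewrite dVs dU0 mulr0 expr0n addr0 => /eqP; rewrite eq_sym oner_eq0.
have [_ _ out] := nuP s.
set a := dot (nu (gamma s)) (e.2, - e.1); set b := dot (nu (gamma s)) e.
have aE : a = - orient s * dV s.
  by rewrite /a normal_rot /dot /rot90 /dV /dot /= /GRing.scale /=; ring.
have bE : b = orient s * dU s.
  by rewrite /b normal_rot /dot /rot90 /dU /dot /= /GRing.scale /=; ring.
(* In the chart, [psi t < 0] says that [gamma s - t *: nu (gamma s)] is in [D]. As [psi 0 = 0] and
   this holds for small positive [t], the derivative of [psi] at 0 is at most 0. *)
pose psi (t : R) := phi (U s - t * a) - V s + t * b.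
have dpsi : is_derive (0 : R) (1 : R) psi (derive1 phi (U s) * - a + b).
  have dlin : is_derive (0 : R) (1 : R) (fun t => U s - t * a) (- a).
    have := is_deriveB (is_derive_cst (U s) (0 : R) 1) (is_deriveM (is_derive_id (0 : R) 1) (is_derive_cst a (0 : R) 1)).
    by move=> /is_derive_eq; apply; rewrite /GRing.scale /=; ring.
  have dphi : is_derive (U s - 0 * a) (1 : R) phi (derive1 phi (U s)).
    rewrite mul0r subr0.
    by case: phi_C1 => h _; apply: DeriveDef; [exact: h|rewrite derive1E].
  have := is_deriveD (is_deriveB (@is_derive1_comp R phi (fun t => U s - t * a) 0 _ _ dphi dlin) (is_derive_cst (V s) (0 : R) 1))
    (is_deriveM (is_derive_id (0 : R) 1) (is_derive_cst b (0 : R) 1)).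
  by move=> /is_derive_eq; apply; rewrite /GRing.scale /=; ring.
have psi0 : psi 0 = 0.
  rewrite /psi !mul0r subr0 addr0 /V frontier_graph ?subrr//.
  exact: gamma_frontier gammaP s.
have psi_lt0 : \forall t \near (0 : R)^'+, psi t < 0.
  have c : {for 0, continuous (fun t : R => enorm (gamma s - t *: nu (gamma s) - x0))}.
    apply: (@continuous_comp _ _ _ (fun t : R => gamma s - t *: nu (gamma s)) (fun x => enorm (x - x0))).
      apply: cvgB; first exact: cvg_cst.
      by apply: cvgZr_tmp; exact: cvg_id.
    exact: continuous_enormB.
  have n1 : \forall t \near (0 : R), enorm (gamma s - t *: nu (gamma s) - x0) < r.
    by apply: (cvgr_lt _ c); rewrite scale0r subr0.
  have n2 : \forall t \near (0 : R)^'+, enorm (gamma s - t *: nu (gamma s) - x0) < r.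
    exact: cvg_within n1.
  apply: filterS2 n2 out => t tr [_ /(chart tr)].
  rewrite /psi /U /V /a /b /dot /= /GRing.scale /= => h; rewrite -subr_lt0 in h.
  by apply: le_lt_trans h; rewrite le_eqVlt; apply/orP; left; apply/eqP;
    rewrite -!addrA; congr (phi _ + _); ring.
have : derive1 phi (U s) * - a + b <= 0.
  rewrite leNgt; apply/negP => pos.
  have [dpsi_ex dpsiE] := dpsi.
  have q : (fun h : R => h^-1 *: (psi (h *: 1 + 0) - psi 0)) @ 0^' -->
      derive1 phi (U s) * - a + b by rewrite -dpsiE; exact: dpsi_ex.
  have q_gt0 : \forall h \near (0 : R), h != 0 -> 0 < h^-1 *: (psi (h *: 1 + 0) - psi 0).
    exact: (cvgr_gt _ q _ pos).
  have q_gt0' : \forall h \near (0 : R)^'+, h != 0 -> 0 < h^-1 *: (psi (h *: 1 + 0) - psi 0).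
    exact: cvg_within q_gt0.
  have [t [[t0 qt] pt]] := filter_ex (filterI (filterI (nbhs_right_gt 0) q_gt0') psi_lt0).
  move: (qt (lt0r_neq0 t0)).
  rewrite psi0 subr0 addr0 /GRing.scale /= mulr1 pmulr_rgt0 ?invr_gt0//.
  by rewrite ltNge (ltW pt).
(* Since [dV = phi' * dU], the derivative of [psi] at 0 is [orient s * dU s] times the positive
   factor [1 + phi' ^+ 2]. *)
rewrite aE bE dVs => h.
have : orient s * dU s * (1 + derive1 phi (U s) ^+ 2) <= 0.
  by rewrite (_ : _ * _ = derive1 phi (U s) * - (- orient s * (derive1 phi (U s) * dU s)) + orient s * dU s)//; ring.
by rewrite pmulr_lle0// ltr_pwDl// sqr_ge0.
Qed.

End chart.

(** Within one chart [orient], which is 1 or -1, has the sign opposite to that of the nonzero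
    continuous function [dU]. The curve being 1-Lipschitz, parameters within [r] of [s0] stay in the
    chart. *)
Lemma orient_locally_cst s0 : exists2 d, 0 < d &
  forall s, `|s - s0| < d -> orient s = orient s0.
Proof.
have [r [e [phi [r0 e1 phi1 chart]]]] := C1D (gamma_frontier gammaP s0).
pose dU s := dot (derive1 gamma s) (e.2, - e.1).
have gs0 : enorm (gamma s0 - gamma s0) < r.
  by rewrite subrr /enorm /dot /= mul0r addr0 sqrtr0.
have [dU0 odU0] : dU s0 != 0 /\ orient s0 * dU s0 <= 0 := orient_dU e1 phi1 chart gs0.
have dUc : continuous dU.
  move=> s; rewrite /dU /dot; apply: cvgD.
    by apply: cvgM; [exact: (continuous_dgamma1 gammaP)|exact: cvg_cst].
  by apply: cvgM; [exact: (continuous_dgamma2 gammaP)|exact: cvg_cst].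
have [||d d0 Hd] := @continuous_gt_near R (fun s => dU s * dU s0) s0 0.
- by apply: cvgM; [exact: dUc|exact: cvg_cst].
- by rewrite -expr2 lt_neqAle eq_sym sqrf_eq0 dU0 sqr_ge0.
exists (Num.min d r) => [|s]; first by rewrite lt_min d0.
rewrite lt_min => /andP[sd sr].
have gs : enorm (gamma s - gamma s0) < r.
  have [ss0|/ltW ss0] := leP s s0.
    by apply: le_lt_trans (gamma_lipschitz gammaP ss0) _; rewrite -normrN opprB ger0_norm ?subr_ge0// in sr.
  rewrite (_ : enorm _ = enorm (gamma s0 - gamma s)).
    by apply: le_lt_trans (gamma_lipschitz gammaP ss0) _; rewrite ger0_norm ?subr_ge0// in sr.
  by rewrite /enorm /dot /=; congr Num.sqrt; ring.
have [_ odU] : dU s != 0 /\ orient s * dU s <= 0 := orient_dU e1 phi1 chart gs.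
have {Hd} ss : 0 < dU s * dU s0 := Hd s sd.
move: (dU s) (dU s0) ss odU odU0 => x y ss.
move: (orient s) (orient s0) (orient_pm1 s) (orient_pm1 s0) => o o0.
case=> -> [] -> //; rewrite ?mul1r ?mulN1r ?oppr_le0 => hx hy; move: ss; rewrite ltNge.
  by rewrite mulr_le0_ge0.
by rewrite mulr_ge0_le0.
Qed.

Lemma orient_cst : exists2 k, k ^+ 2 = 1 & forall s, 0 <= s -> orient s = k.
Proof.
have [k orient0] : exists k, orient 0 = k by exists (orient 0).
exists k => [|s s0]; first by rewrite -orient0 orient_sqr.
apply: (@real_induction R s (fun b => orient b = k) s0 orient0) => c _.
have [d d0 Hd] := orient_locally_cst c.
exists d; [exact: d0|move=> a b a0 ab ca bc Pa].
have ac : `|a - c| < d.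
  by rewrite ltr_norml; apply/andP; clear -d0 ab ca bc; split; lra.
have bc' : `|b - c| < d.
  by rewrite ltr_norml; apply/andP; clear -d0 ab ca bc; split; lra.
exact: etrans (Hd b bc') (etrans (esym (Hd a ac)) Pa).
Qed.

End orientation.

Lemma sum_mul_sum (R : comNzRingType) (I : finType) (v a b : I -> R) (l : R) :
  (\sum_i v i * a i) * (\sum_j v j * b j) * l =
  \sum_i \sum_j v i * v j * (a i * b j * l).
Proof.
rewrite !mulr_suml; apply: eq_bigr => i _.
by rewrite mulr_sumr mulr_suml; apply: eq_bigr => j _; ring.
Qed.

(** * Gram matrices of the logarithmic kernel *)

Section gram.
Context {R : realType} (D : set (R * R)) (L : R) (gamma : R -> R * R).
Hypothesis D0 : D !=set0.
Hypothesis oD : open D.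
Hypothesis bD : bounded_set D.
Hypothesis gammaP : arclength_param D L gamma.
Local Notation C := (complex R).
Local Notation mu := (@lebesgue_measure R).
Local Notation E := (`[0, L[%classic : set R).
Local Notation EE := (E `*` E).
Local Notation RR := (measurableTypeR R * measurableTypeR R)%type.
Local Notation pm := (@plane_measure R).

Let L_gt0 : 0 < L := period_gt0 gammaP.
Let g1 s := (gamma s).1.
Let g2 s := (gamma s).2.
Let dg1 s := (derive1 gamma s).1.
Let dg2 s := (derive1 gamma s).2.
Let K : RR -> R := curve_sqdist g1 g2.

Definition density (p : {poly C}) (s : R) : R :=
  Re (p^`().[toC (gamma s)] * toC (derive1 gamma s)).

Lemma is_derive_density p s :
  is_derive s (1 : R) (fun s => Re p.[toC (gamma s)]) (density p s).
Proof.
exact: (is_derive_Re_Im_poly p (is_derive_gamma1 gammaP s) (is_derive_gamma2 gammaP s)).1.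
Qed.

Lemma continuous_density p : continuous (density p).
Proof.
have gc : continuous gamma.
  move=> t; apply: differentiable_continuous; apply/derivable1_diffP.
  by case: gammaP => _ [].
have [cr ci] := continuous_Re_Im_poly p^`().
have -> : density p = fun s =>
    Re p^`().[toC (gamma s)] * dg1 s - Im p^`().[toC (gamma s)] * dg2 s.
  by apply/funext => s; rewrite /density; case: (p^`().[_]).
move=> s; apply: cvgB; apply: cvgM.
- by apply: (@continuous_comp _ _ _ gamma (fun x => Re p^`().[toC x])); [exact: gc|exact: cr].
- exact: (continuous_dgamma1 gammaP).
- by apply: (@continuous_comp _ _ _ gamma (fun x => Im p^`().[toC x])); [exact: gc|exact: ci].
- exact: (continuous_dgamma2 gammaP).
Qed.

Lemma density_mean0 p : \int[mu]_(t in E) density p t = 0.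
Proof.
have cd := @continuous_density p.
rewrite Rintegral_itv_bndo_bndc; last exact: continuous_integrable_itv.
rewrite /Rintegral (@continuous_FTC2 R (density p) (fun s => Re p.[toC (gamma s)]) 0 L)//.
- by rewrite (gamma_closed gammaP) subee.
- exact: continuous_subspaceT.
- have ch := continuous_of_is_derive (is_derive_density p).
  split.
  + by move=> x _; have := is_derive_density p x; exact: @ex_derive.
  + by apply: cvg_at_right_filter; exact: ch.
  + by apply: cvg_at_left_filter; exact: ch.
- move=> x _; rewrite derive1E; have [_ ->//] := is_derive_density p x.
Qed.

Lemma density_neq0 (p : {poly C}) : (1 < size p)%N -> exists2 s, E s & density p s != 0.
Proof.
move=> sp; apply: contrapT => h.
have d0 s : E s -> density p s = 0.
  by move=> Es; apply: contrapT => /eqP ds; apply: h; exists s.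
apply: (frontier_not_level_set (c := Re p.[toC (gamma 0)]) D0 oD bD sp).
case: (gammaP) => _ _ _ _ [_ <-] _ [s /= /[!in_itv]/= /andP[s0 sL] <-].
have [|c /[!in_itv]/= /andP[c0 cs]] := @MVT_segment R _ _ 0 s s0 (fun x _ => is_derive_density p x).
  exact/continuous_subspaceT/(continuous_of_is_derive (is_derive_density p)).
rewrite d0 ?mul0r => [/eqP|]; first by rewrite subr_eq0 => /eqP.
by rewrite /= in_itv/= c0 (le_lt_trans cs).
Qed.

(** The factor 4 instead of 2 comes from the square inside the logarithm. The equality persists on
    the diagonal, where both logarithms take the default value 0. *)
Lemma Gam_gammaE z : Gam (gamma z.1 - gamma z.2) = (4 * pi)^-1 * ln (K z) :> R.
Proof.
have ln_sqrt (y : R) : 0 <= y -> ln (Num.sqrt y) = ln y / 2.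
  rewrite le_eqVlt => /predU1P[<-|y0]; first by rewrite sqrtr0 ln0// mul0r.
  by rewrite -[in RHS](sqr_sqrtr (ltW y0)) lnXn ?sqrtr_gt0// mulr2n; field.
have KE : K z = dot (gamma z.1 - gamma z.2) (gamma z.1 - gamma z.2).
  by rewrite /K /curve_sqdist /sqdist /dot /= !expr2.
rewrite /Gam /enorm -KE ln_sqrt ?curve_sqdist_ge0//.
have pi0 : pi != 0 :> R by rewrite gt_eqF// pi_gt0.
by move: pi pi0 => x x0; field.
Qed.

Let log_form (f h : R -> R) : R := \int[pm]_(z in EE) (f z.1 * h z.2 * ln (K z)).

Let integrable_log_form (f h : R -> R) : continuous f -> continuous h ->
  pm.-integrable EE (EFin \o (fun z => f z.1 * h z.2 * ln (K z))).
Proof.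
exact: (integrable_mul_ln L_gt0 (is_derive_gamma1 gammaP) (is_derive_gamma2 gammaP)
  (continuous_dgamma1 gammaP) (continuous_dgamma2 gammaP) (unit_speed_gamma gammaP)).
Qed.

Lemma log_form_sym (f h : R -> R) : continuous f -> continuous h -> log_form f h = log_form h f.
Proof.
move=> cf ch; rewrite /log_form.
have mF : measurable_fun [set: RR] (fun z : RR => f z.1 * h z.2 * ln (K z)).
  apply: measurable_funM.
    by have [] : bounded_kernel L (fun z => f z.1 * h z.2)
      by apply: bounded_kernelM; [exact: bounded_kernel_fst|exact: bounded_kernel_snd].
  apply: (measurableT_comp (@measurable_ln R)).
  exact: (bounded_curve_sqdist L (is_derive_gamma1 gammaP) (is_derive_gamma2 gammaP)).1.
rewrite -(Rintegral_square_swap mF (integrable_log_form cf ch)).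
apply: eq_Rintegral => z _ /=; rewrite [h _ * _]mulrC; congr (_ * ln _).
by rewrite /K /curve_sqdist /sqdist /=; ring.
Qed.

Lemma log_form_density_lt0 (p : {poly C}) : (1 < size p)%N -> log_form (density p) (density p) < 0.
Proof.
move=> sp; have [s Es ds] := density_neq0 sp.
apply: (log_energy_lt0 L_gt0 (is_derive_gamma1 gammaP) (is_derive_gamma2 gammaP)
  (continuous_dgamma1 gammaP) (continuous_dgamma2 gammaP) (unit_speed_gamma gammaP)
  (gamma_injective gammaP) _ _ (@continuous_density p) (density_mean0 p) Es ds).
- by rewrite (gamma_closed gammaP).
- by rewrite (gamma_closed gammaP).
Qed.

Definition gram n (pf : 'I_n -> {poly C}) : 'M[R]_n :=
  \matrix_(i, j) \int[pm]_(z in EE)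
    (density (pf j) z.1 * density (pf i) z.2 * Gam (gamma z.1 - gamma z.2)).

Lemma gramE n (pf : 'I_n -> {poly C}) i j :
  gram pf i j = (4 * pi)^-1 * log_form (density (pf j)) (density (pf i)).
Proof.
rewrite mxE -RintegralZl; [|exact: measurable_square|]; last first.
  by apply: integrable_log_form; exact: continuous_density.
by apply: eq_Rintegral => z _; rewrite Gam_gammaE mulrCA.
Qed.

Lemma density_comb n (pf : 'I_n -> {poly C}) (v : 'I_n -> R) s :
  density (\sum_i Complex (v i) 0 *: pf i) s = \sum_i v i * density (pf i) s.
Proof.
rewrite /density raddf_sum /= horner_sum mulr_suml Re_sum; apply: eq_bigr => i _.
rewrite derivZ hornerZ -mulrA.
by move: ((pf i)^`().[_] * _) => [a b] /=; rewrite mul0r subr0.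
Qed.

(** The hypothesis is independence over the reals modulo constants: a nontrivial real combination
    must have positive degree for its density not to vanish. *)
Lemma gram_symmetric_negdef n (pf : 'I_n -> {poly C}) :
  (forall v : 'I_n -> R, (exists i, v i != 0) ->
    (1 < size (\sum_i Complex (v i) 0 *: pf i)%R)%N) ->
  symmetric_negdef (gram pf).
Proof.
move=> indep; have cd i : continuous (density (pf i)) := @continuous_density (pf i).
split; first by apply/matrixP => i j; rewrite mxE !gramE log_form_sym.
move=> v v0.
have [i vi] : exists i, v i 0 != 0.
  apply: contrapT => h; move: v0 => /eqP; apply; apply/matrixP => i j.
  by rewrite ord1 mxE; apply: contrapT => /eqP vi; apply: h; exists i.
have := log_form_density_lt0 (indep (v^~ 0) (ex_intro _ i vi)).
suff -> : (v^T *m gram pf *m v) 0 0 = (4 * pi)^-1 *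
    log_form (density (\sum_i Complex (v i 0) 0 *: pf i)) (density (\sum_i Complex (v i 0) 0 *: pf i)).
  by move=> h; rewrite pmulr_rlt0// invr_gt0 mulr_gt0// pi_gt0.
transitivity (\sum_j \sum_i (4 * pi)^-1 * (v j 0 * v i 0 * log_form (density (pf j)) (density (pf i)))).
  rewrite mxE; apply: eq_bigr => j _; rewrite mxE mulr_suml; apply: eq_bigr => k _.
  by rewrite gramE mxE; ring.
under eq_bigr do rewrite -mulr_sumr; rewrite -mulr_sumr; congr (_ * _).
have il j k := integrable_log_form (cd j) (cd k).
have ilv j k : pm.-integrable EE (EFin \o (fun z =>
    v j 0 * v k 0 * (density (pf j) z.1 * density (pf k) z.2 * ln (K z)))).
  exact: (integrableZl (measurable_square L) (v j 0 * v k 0) (il j k)).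
transitivity (\int[pm]_(z in EE) (\sum_j \sum_k
    (v j 0 * v k 0 * (density (pf j) z.1 * density (pf k) z.2 * ln (K z))))).
  have mEE := measurable_square L.
  rewrite Rintegral_sum//; last by move=> j; exact: integrable_Rsum.
  apply: eq_bigr => j _; rewrite Rintegral_sum//; apply: eq_bigr => k _.
  by rewrite RintegralZl.
by apply: eq_Rintegral => z _; rewrite !density_comb sum_mul_sum.
Qed.

End gram.

(** * Independence of the basis polynomials and the matrices P and Q *)

Section instances.
Context {R : realType}.
Local Notation C := (complex R).

(** Only two indices, of opposite parities, share a degree, and their coefficients there are one
    real and the other imaginary. They cannot cancel. *)
Lemma size_comb_poly_of_index n (v : 'I_n -> R) : (exists i, v i != 0) ->
  (1 < size (\sum_i Complex (v i) 0 *: poly_of_index i : {poly C})%R)%N.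
Proof.
move=> [i vi]; set p := \sum_i _.
suff pi : p`_(i./2.+1) != 0.
  by rewrite ltnNge; apply: contra pi => sp; rewrite nth_default// (leq_trans sp).
have coefE j : (Complex (v j) 0 *: poly_of_index j : {poly C})`_(i./2.+1) =
    if i./2 == j./2 then (if odd j then Complex 0 (- v j) else Complex (v j) 0) else 0.
  rewrite /poly_of_index !coefZ coefXn eqSS.
  have [_|_] := eqVneq i./2 j./2; last by rewrite !mulr0.
  rewrite mulr1; case: ifP => _; last by rewrite mulr1.
  by apply/eqP; rewrite eq_complex /=; apply/andP; split; apply/eqP; ring.
have neq_parity (j : 'I_n) : j != i -> i./2 = j./2 -> odd j = ~~ odd i.
  move=> ji ij; case: (odd j =P odd i) => [oji|]; last by case: (odd j) (odd i) => [] [].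
  by move: ji; rewrite -val_eqE /= -(odd_double_half j) oji -ij odd_double_half eqxx.
have pE : p`_(i./2.+1) = \sum_(j < n) (if i./2 == j./2 then
    (if odd j then Complex 0 (- v j) else Complex (v j) 0) else 0 : C).
  by rewrite coef_sum; apply: eq_bigr => j _; rewrite coefE.
have [oi|oi] := boolP (odd i).
  suff : Im p`_(i./2.+1) != 0 by apply: contra_neq => ->.
  rewrite pE Im_sum (bigD1 i)//= eqxx oi /= big1 ?addr0 ?oppr_eq0// => j ji.
  by case: eqP => // /(neq_parity j ji) ->; rewrite oi.
suff : Re p`_(i./2.+1) != 0 by apply: contra_neq => ->.
rewrite pE Re_sum (bigD1 i)//= eqxx (negbTE oi) /= big1 ?addr0// => j ji.
by case: eqP => // /(neq_parity j ji) ->; rewrite oi.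
Qed.

End instances.

Section matrices.
Context {R : realType} (D : set (R * R)) (L : R) (gamma : R -> R * R).
Context (nu : R * R -> R * R).
Hypothesis D0 : D !=set0.
Hypothesis oD : open D.
Hypothesis bD : bounded_set D.
Hypothesis C1D : C1_boundary D.
Hypothesis gammaP : arclength_param D L gamma.
Hypothesis nuP : outward_unit_normal D gamma nu.
Local Notation C := (complex R).

Lemma Ppoly_funE i : Ppoly i.+1 = (fun x => Re (poly_of_index i).[toC x]) :> (R * R -> R).
Proof. by apply/funext => x; exact: PpolyE. Qed.

Lemma dtau_Ppoly i s : dtau gamma (Ppoly i.+1) s = density gamma (poly_of_index i) s.
Proof.
rewrite /dtau Ppoly_funE derive1E.
by have [_ <-] := is_derive_density gammaP (poly_of_index i) s.
Qed.

Lemma matP_negdef n : symmetric_negdef (matP L gamma n).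
Proof.
have -> : matP L gamma n = gram L gamma (fun i => poly_of_index i).
  apply/matrixP => i j; rewrite !mxE; apply: eq_Rintegral => z _.
  congr (_ * _).
  rewrite (dtau_Ppoly i z.2) (dtau_Ppoly j z.1).
  exact: mulrC.
apply: (gram_symmetric_negdef D0 oD bD gammaP) => v; exact: size_comb_poly_of_index.
Qed.

(* By the Cauchy-Riemann equations, with k the constant value of orient. *)
Lemma Qflux_density : exists2 k : R, k != 0 & forall i s, 0 <= s ->
  Qflux nu i.+1 (gamma s) = density gamma (Complex 0 k *: poly_of_index i) s.
Proof.
have [k k1 Hk] := orient_cst oD C1D gammaP nuP.
exists k => [|i s s0].
  by apply: contra_eq_neq k1 => ->; rewrite expr0n eq_sym oner_eq0.
rewrite /Qflux /dnu Ppoly_funE grad_Re_poly (normal_rot gammaP nuP) Hk//.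
move: (poly_of_index i) => p; rewrite /density derivZ hornerZ.
move: (p^`().[_]) (derive1 gamma s) => [a b] [c d] /=.
rewrite (_ : dot _ _ = a * (k * - d) + - b * (k * c))//.
by ring.
Qed.

Lemma matQ_negdef n : symmetric_negdef (matQ L gamma nu n).
Proof.
have [k k0 Hk] := Qflux_density.
have -> : matQ L gamma nu n = gram L gamma (fun i => Complex 0 k *: poly_of_index i).
  apply/matrixP => i j; rewrite !mxE; apply: eq_Rintegral => z.
  rewrite inE /= !in_itv/= => -[/andP[z1 _] /andP[z2 _]].
  by rewrite !Hk.
apply: (gram_symmetric_negdef D0 oD bD gammaP) => v /size_comb_poly_of_index.
(* Multiplication by the nonzero number i k, which carries tangential derivatives to normal ones,
   preserves degrees and hence independence. *)
rewrite -(@size_scale _ (Complex 0 k)); last by rewrite eq_complex /= negb_and k0 orbT.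
rewrite scaler_sumr (eq_bigr (fun i => Complex (v i) 0 *: (Complex 0 k *: poly_of_index i)))//.
by move=> i _; rewrite scalerA mulrC -scalerA.
Qed.

End matrices.

Theorem mainTheorem2 (R : realType) (D : set (R * R))
    (D_domain : domain D) (D_bounded : bounded_set D)
    (D_sc : simply_connected D) (D_C1 : C1_boundary D)
    (D_center : center_of_mass D = (0, 0))
    (L : R) (gamma : R -> R * R) (gammaP : arclength_param D L gamma)
    (nu : R * R -> R * R) (nuP : outward_unit_normal D gamma nu)
    (gam0 gam1 : R) (gam0_gt0 : 0 < gam0) (gam1_gt0 : 0 < gam1)
    (N1 N2 : nat) (N1_gt0 : (0 < N1)%N) (N2_gt0 : (0 < N2)%N)
    (kappa : R) (kappa_lt1 : kappa < 1) :
  let k := gam1 / gam0 in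
  let np := (2 * N1)%N in
  let nq := (2 * N2)%N in
  let M := matM L gamma nu k np nq in
  let diam_lt := forall x y, frontier D x -> frontier D y ->
                   enorm (x - y) < kappa in
  (L < 2 * kappa -> diam_lt) /\
  (diam_lt ->
    [/\ symmetric_negdef (matP L gamma np),
        symmetric_negdef (matQ L gamma nu nq),
        0 < \det M &
        forall B : 'cV[R]_(np + nq), exists! X : 'cV[R]_(np + nq), M *m X = B]).
Proof.
move=> k np nq M diam_lt; have [D0 oD _] := D_domain.
split; first exact: diameter_lt gammaP kappa.
move=> _.
have Pneg := matP_negdef D0 oD D_bounded gammaP np.
have Qneg := matQ_negdef D0 oD D_bounded D_C1 gammaP nuP nq.
have detM : 0 < \det M.
  apply: block_det_gt0; last 2 first.
  - exact: Pneg.2.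
  - exact: Qneg.2.
  - by rewrite /np /nq !mul2n oddD !odd_double.
  - by rewrite divr_gt0.
split=> // B.
have uM : M \in unitmx by rewrite unitmxE unitfE gt_eqF.
exists (invmx M *m B); split; first by rewrite mulKVmx.
by move=> X <-; rewrite mulKmx.
Qed.
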